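(* Let $K$ be a field, let $S$ be a positively graded $K$-algebra, let $M=\bigoplus_{n\ge 0}M_n$ be a finitely generated graded $S$-module, and let $w>0$ be a real number. If $f_1,\ldots,f_p \in S$ is a regular sequence on $M$ consisting of homogeneous elements with $\deg(f_i)=k_i$, then $$\zeta_{M/(f_1,\ldots,f_p)M}(z,w) = \zeta_M(z,w) + \sum_{\ell=1}^p (-1)^{\ell} \sum_{1\leq i_1 < \cdots < i_{\ell}\leq p} \zeta_M(z,w+k_{i_1}+\cdots+k_{i_{\ell}}).$$
   Context: A positively graded $K$-algebra is a finitely generated graded $K$-algebra $S=\bigoplus_{n\ge0}S_n$ with $S_0=K$. For a finitely generated graded $S$-module $M=\bigoplus_{n\ge0}M_n$ put $H(M,n)=\dim_K M_n$ and, for real $w>0$, $\zeta_M(z,w)=\sum_{n\ge 0}\frac{H(M,n)}{(n+w)^z}$. The series converges absolutely for $\operatorname{Re} z>\dim M$ and is understood elsewhere by its meromorphic continuation to $\mathbb C$. *)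

(* Defs.v *)
From HB Require Import structures.
From mathcomp Require Import all_boot all_order all_algebra.
From mathcomp Require Import generic_quotient ring_quotient complex.
From mathcomp Require Import all_classical all_reals all_analysis.

Set Implicit Arguments.
Unset Strict Implicit.
Unset Printing Implicit Defensive.

Import Order.TTheory GRing.Theory Num.Theory.
Import numFieldNormedType.Exports.

Local Open Scope ring_scope.
Local Open Scope classical_set_scope.
Local Open Scope quotient_scope.

(* Internal gradings V = \bigoplus_n V_ n by additive subgroups. *)
Record is_grading (V : zmodType) (V_ : nat -> set V) : Prop := IsGrading {
  grading0 : forall n, V_ n 0;
  gradingB : forall n x y, V_ n x -> V_ n y -> V_ n (x - y);
  grading_sum : forall x, exists N (c : nat -> V),
    (forall n, V_ n (c n)) /\ x = \sum_(n < N) c n;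
  grading_direct : forall N (c : nat -> V),
    (forall n, V_ n (c n)) -> \sum_(n < N) c n = 0 ->
    forall n, (n < N)%N -> c n = 0 }.

(* S_ n is a K-subspace because K%:A = S_ 0 and S_ 0 * S_ n is in S_ n. *)
Record positively_graded (K : fieldType) (S : comAlgType K)
    (S_ : nat -> set S) : Prop := PositivelyGraded {
  pgr_grading : is_grading S_;
  pgr_mul : forall m n a b, S_ m a -> S_ n b -> S_ (m + n)%N (a * b);
  pgr_zero : S_ 0%N = range (fun a : K => a%:A);
  pgr_fg : exists gens : seq S, forall A : {pred S},
    GRing.subalg_closed A -> {subset gens <= A} -> forall a, a \in A }.

Record fg_graded_module (K : fieldType) (S : comAlgType K) (S_ : nat -> set S)
    (M : lmodType S) (M_ : nat -> set M) : Prop := FgGradedModule {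
  fgm_grading : is_grading M_;
  fgm_scale : forall m n a x, S_ m a -> M_ n x -> M_ (m + n)%N (a *: x);
  fgm_fg : exists gens : seq M, forall A : {pred M},
    GRing.submod_closed A -> {subset gens <= A} -> forall x, x \in A }.

Section QuotientModule.
Variables (S : comNzRingType) (M : lmodType S) (f : seq S).

(* the submodule (f_1, ..., f_p) M *)
Definition seq_submod : {pred M} :=
  fun x => `[< exists m : nat -> M, x = \sum_(i < size f) f`_i *: m i >].

Lemma seq_submod_closed : GRing.submod_closed seq_submod.
Proof.
split=> [|a x y /asboolP[m ->] /asboolP[m' ->]]; apply/asboolP.
  by exists (fun=> 0); rewrite big1 // => i _; rewrite scaler0.
exists (fun i => a *: m i + m' i).
rewrite scaler_sumr -big_split; apply: eq_bigr => i _ /=.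
by rewrite scalerDr !scalerA mulrC.
Qed.

HB.instance Definition _ :=
  GRing.isSubmodClosed.Build S M seq_submod seq_submod_closed.

(* the quotient module M / (f_1, ..., f_p) M *)
Definition quot_mod := Quotient.quot seq_submod.

HB.instance Definition _ := GRing.Zmodule.on quot_mod.

Definition quot_pi (x : M) : quot_mod := \pi_(Quotient.quot seq_submod) x.

Definition quot_repr (x : quot_mod) : M :=
  repr (x : Quotient.quot seq_submod).

Lemma quot_reprK : cancel quot_repr quot_pi.
Proof. exact: reprK. Qed.

Lemma quot_pi_eq x y : (quot_pi x == quot_pi y) = (x - y \in seq_submod).
Proof. by rewrite Quotient.idealrBE. Qed.

Lemma quot_piD x y : quot_pi (x + y) = quot_pi x + quot_pi y.
Proof. exact: (raddfD (\pi_(Quotient.quot seq_submod))). Qed.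

Definition quot_scale (a : S) (x : quot_mod) : quot_mod :=
  quot_pi (a *: quot_repr x).

Lemma quot_scale_pi a x : quot_scale a (quot_pi x) = quot_pi (a *: x).
Proof.
apply/eqP; rewrite quot_pi_eq -scalerBr.
by apply: rpredZ; rewrite -quot_pi_eq quot_reprK.
Qed.

Lemma quot_scaleA a b x :
  quot_scale a (quot_scale b x) = quot_scale (a * b) x.
Proof. by rewrite -[x]quot_reprK !quot_scale_pi scalerA. Qed.

Lemma quot_scale1 : left_id 1 quot_scale.
Proof. by move=> x; rewrite -[x]quot_reprK quot_scale_pi scale1r. Qed.

Lemma quot_scaleDr : right_distributive quot_scale +%R.
Proof.
move=> a x y; rewrite -[x]quot_reprK -[y]quot_reprK -quot_piD !quot_scale_pi.
by rewrite -quot_piD scalerDr.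
Qed.

Lemma quot_scaleDl x : {morph quot_scale^~ x : a b / a + b}.
Proof.
by move=> a b; rewrite -[x]quot_reprK !quot_scale_pi scalerDl quot_piD.
Qed.

HB.instance Definition _ := GRing.Zmodule_isLmodule.Build S quot_mod
  quot_scaleA quot_scale1 quot_scaleDr quot_scaleDl.

Definition quot_grading (M_ : nat -> set M) : nat -> set quot_mod :=
  fun n => quot_pi @` M_ n.

End QuotientModule.

Arguments quot_pi {S M} f x.
Arguments quot_grading {S M} f M_ n.

(* f_(i+1) is a nonzerodivisor on M / (f_1, ..., f_i) M for every i, and
   M / (f_1, ..., f_p) M is not zero. *)
Definition regular_sequence (S : comNzRingType) (M : lmodType S) (f : seq S) :=
  (forall i, (i < size f)%N ->
     forall x : quot_mod M (take i f), f`_i *: x = 0 -> x = 0) /\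
  (exists x : quot_mod M f, x <> 0).

Section HilbertFunction.
Variables (K : fieldType) (S : comAlgType K) (N : lmodType S).

(* K acts on N through k |-> k%:A. *)
Definition is_basis (V : set N) (d : nat) (b : 'I_d -> N) : Prop :=
  [/\ forall i, V (b i),
      forall c : 'I_d -> K, \sum_i (c i)%:A *: b i = 0 -> forall i, c i = 0 &
      forall x, V x -> exists c : 'I_d -> K, x = \sum_i (c i)%:A *: b i].

(* the K-dimension of V (0 if V is infinite-dimensional) *)
Definition dimK (V : set N) : nat :=
  xget 0%N [set d | exists b : 'I_d -> N, is_basis V b].

Definition hilbert (N_ : nat -> set N) (n : nat) : nat := dimK (N_ n).

End HilbertFunction.

Section ComplexFunctions.
Variable R : realType.
Local Notation C := (R[i]^o)%type.

(* x ^ z = exp (z ln x) for x > 0 *)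
Definition cpow (x : R) (z : C) : C :=
  let t := complex.Im z * ln x in
  ((expR (complex.Re z * ln x))%:C * (cos t +i* sin t))%C.

Definition analytic_at (F : C -> C) (a : C) : Prop :=
  exists c : nat -> C, \forall z \near a,
    series (fun n => c n * (z - a) ^+ n) @ \oo --> F z.

(* A Laurent expansion with finite principal part on a punctured
   neighbourhood of a; the value of F at a is irrelevant. *)
Definition meromorphic_at (F : C -> C) (a : C) : Prop :=
  exists (m : nat) (c : nat -> C), \forall z \near a^',
    series (fun n => c n * (z - a) ^+ n) @ \oo --> (z - a) ^+ m * F z.

Definition meromorphic (F : C -> C) : Prop := forall a, meromorphic_at F a.

Section Zeta.
Variables (K : fieldType) (S : comAlgType K) (N : lmodType S).
Variables (N_ : nat -> set N) (w : R).

Definition zeta_term (z : C) (n : nat) : C :=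
  (hilbert N_ n)%:R / cpow (n%:R + w) z.

Definition zeta_abs_cvg (z : C) : Prop :=
  cvgn (series (fun n => `|zeta_term z n| : C)).

Definition zeta_series (z : C) : C := limn (series (zeta_term z)).

Definition zeta_continuation (F : C -> C) : Prop :=
  meromorphic F /\ forall z, zeta_abs_cvg z -> F z = zeta_series z.

(* F is regular at z with value F z; imposing analyticity at z discards the
   arbitrary values of F at its poles and removable singularities. *)
Definition zeta_continuation_at (z : C) (F : C -> C) : Prop :=
  zeta_continuation F /\ analytic_at F z.

(* z is not a pole of the zeta function *)
Definition zeta_regular (z : C) : Prop :=
  zeta_abs_cvg z \/ exists F, zeta_continuation_at z F.

(* By the identity theorem the value F z does not depend on F. *)
Definition zeta (z : C) : C :=
  if `[< zeta_abs_cvg z >] then zeta_series z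
  else xget 0 [set F z | F in zeta_continuation_at z].

End Zeta.
End ComplexFunctions.

(* Main.v *)
(* Multiplication by f_(i+1) is injective on M/(f_1,...,f_i)M, so that the
   Hilbert functions satisfy h_i(n) = h_(i+1)(n) + h_i(n - k_(i+1)). By
   inclusion-exclusion the Hilbert function of M/(f_1,...,f_p)M is an alternating
   sum of shifts of that of M, which gives the identity wherever the Dirichlet
   series converge absolutely; since h_0 grows at most polynomially, this includes
   a half-plane. To reach z it is enough to follow the horizontal line z + t,
   t >= 0, on which the real and imaginary parts of both sides have real Laurent
   expansions: the difference vanishes for t large, hence, zeros of a Laurent
   expansion being isolated, near every t > 0, hence at t = 0 by right continuity.
   Along this line a Dirichlet series is a combination of real exponentials, so
   its expansion needs no complex exponential series. *)
Require Import Defs.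
From HB Require Import structures.
From mathcomp Require Import all_boot all_order all_algebra.
From mathcomp Require Import generic_quotient ring_quotient complex.
From mathcomp Require Import all_classical all_reals all_analysis.
From mathcomp Require Import ring lra.

Set Implicit Arguments.
Unset Strict Implicit.
Unset Printing Implicit Defensive.

Import Order.TTheory GRing.Theory Num.Theory.
Import numFieldNormedType.Exports.

Local Open Scope ring_scope.
Local Open Scope classical_set_scope.

(** * Real series and Laurent expansions *)

Section RealSeries.
Variable R : realType.
Implicit Types (u v b : nat -> R).

Lemma cvg_series_dominated u b :
  (forall n, `|u n| <= b n) -> cvgn (series b) -> cvgn (series u).
Proof.
move=> ub cb; apply: normed_cvg; apply: series_le_cvg cb => n //=.
exact: le_trans (ub n).
Qed.

Lemma series_tail_le u b N :
  (forall n, `|u n| <= b n) -> cvgn (series b) ->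
  `|limn (series u) - series u N| <= limn (series b) - series b N.
Proof.
move=> ub cb; have cu := cvg_series_dominated ub cb.
have h1 : `|series u n - series u N| @[n --> \oo] -->
    `|limn (series u) - series u N|.
  by apply: cvg_norm; apply: cvgB => //; exact: cvg_cst.
have h2 : series b n - series b N @[n --> \oo] --> limn (series b) - series b N.
  by apply: cvgB => //; exact: cvg_cst.
apply: ler_cvg_to h1 h2 _; near=> n.
have Nn : (N <= n)%N by near: n; exact: nbhs_infty_ge.
rewrite !sub_series_geq //; apply: le_trans (ler_norm_sum _ _ _) _.
exact: ler_sum.
Unshelve. all: by end_near. Qed.

(** Dominated convergence for series: beyond a large [N] both tails are at most the tail of [b], and
    up to [N] the sums are finite and converge termwise. *)
Lemma tannery (T : Type) (F : set_system T) {FF : ProperFilter F}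
    (u : T -> nat -> R) v b :
  cvgn (series b) -> (\forall x \near F, forall n, `|u x n| <= b n) ->
  (forall n, u x n @[x --> F] --> v n) ->
  limn (series (u x)) @[x --> F] --> limn (series v).
Proof.
move=> cb ub uv.
have vb n : `|v n| <= b n.
  have h : `|u x n| @[x --> F] --> `|v n| by exact: cvg_norm.
  apply: (cvgr_to_le h); near=> x.
  by have -> : forall m, `|u x m| <= b m by near: x.
apply/cvgrPdist_lt => e e0.
have e3 : 0 < e / 3 by rewrite divr_gt0.
have /cvgrPdist_lt/(_ _ e3)[N _ /(_ N (leqnn N)) hN] := cb.
have {}hN : limn (series b) - series b N < e / 3.
  by apply: le_lt_trans hN; exact: ler_norm.
have cN : series (u x) N @[x --> F] --> series v N.
  by rewrite /series /=; apply: cvg_big => [|i _]; [exact: add_continuous|].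
move/cvgrPdist_lt/(_ _ e3) : cN => cN.
near=> x.
have ubx : forall n, `|u x n| <= b n by near: x.
have := series_tail_le N ubx cb; have := series_tail_le N vb cb.
have : `|series v N - series (u x) N| < e / 3 by near: x.
set A := limn (series v); set B := limn (series (u x)).
move=> h1 h2 h3.
have -> : A - B = (A - series v N) + (series v N - series (u x) N)
  - (B - series (u x) N) by rewrite !opprB !addrA !subrK.
have -> : e = e / 3 + e / 3 + e / 3 by field.
apply: le_lt_trans (ler_normB _ _) _; apply: ltr_leD.
  apply: le_lt_trans (ler_normD _ _) _; apply: ler_ltD => //.
  exact: le_trans h2 (ltW hN).
exact: le_trans h3 (ltW hN).
Unshelve. all: by end_near. Qed.

End RealSeries.

Section RealLaurent.
Variable R : realType.
Implicit Types (c d : nat -> R) (r s : R).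

Definition pser c s := series (fun n => c n * s ^+ n).

(** Convergence at [r] bounds the terms [c n * r ^+ n], so for s of absolute value at most [r / 2]
    everything after the constant term is dominated by a geometric series of ratio at most one
    half. *)
Lemma pser_near0 c r : 0 < r -> cvgn (pser c r) ->
  exists B, forall s l, `|s| <= r / 2 -> pser c s @ \oo --> l ->
    `|l - c 0%N| <= B * `|s|.
Proof.
move=> r0 /cvg_series_bounded[M [_ /(_ (M + 1))]]; rewrite ltrDl ltr01.
move=> /(_ isT) hB; set B0 := M + 1 in hB.
have {}hB n : `|c n| * r ^+ n <= B0.
  by have := hB n I; rewrite /= normrM normrX (gtr0_norm r0).
have B0_ge0 : 0 <= B0 by apply: le_trans (hB 0%N); rewrite expr0 mulr1.
exists (B0 * 2 / r) => s l sr cl.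
pose q := `|s| / r.
have q0 : 0 <= q by rewrite divr_ge0// ltW.
have q2 : q <= 2^-1 by rewrite ler_pdivrMr// mulrC.
have key n : \sum_(i < n) `|c i.+1 * s ^+ i.+1| <= B0 * q * (2 - 2 * 2^-1 ^+ n).
  elim: n => [|n IH]; first by rewrite big_ord0 expr0 mulr1 subrr mulr0.
  rewrite big_ord_recr /=.
  have h : `|c n.+1 * s ^+ n.+1| <= B0 * q * 2^-1 ^+ n.
    rewrite normrM normrX.
    have -> : `|s| = q * r by rewrite /q divfK// gt_eqF.
    rewrite exprMn mulrCA mulrC.
    apply: le_trans (ler_wpM2r (exprn_ge0 _ q0) (hB n.+1)) _.
    rewrite exprS mulrA; apply: ler_wpM2l; first exact: mulr_ge0.
    by apply: lerXn2r; rewrite ?nnegrE ?invr_ge0.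
  apply: le_trans (lerD IH h) _; rewrite exprS le_eqVlt; apply/orP; left.
  by apply/eqP; field.
have h1 : `|pser c s n.+1 - c 0%N| @[n --> \oo] --> `|l - c 0%N|.
  apply: cvg_norm; apply: cvgB; last exact: cvg_cst.
  by rewrite (cvg_shiftS (pser c s)).
apply: (cvgr_to_le h1); apply: nearW => n.
rewrite /pser seriesEord /= big_ord_recl /= expr0 mulr1 addrAC subrr add0r.
apply: le_trans (ler_norm_sum _ _ _) _; apply: le_trans (key n) _.
have -> : B0 * 2 / r * `|s| = B0 * q * 2 by rewrite /q; ring.
apply: ler_wpM2l; first exact: mulr_ge0.
by rewrite lerBlDr lerDl mulr_ge0// exprn_ge0// invr_ge0.
Qed.

Lemma pser_shift c m s N : (forall i, (i < m)%N -> c i = 0) ->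
  pser c s (N + m)%N = s ^+ m * pser (fun i => c (m + i)%N) s N.
Proof.
move=> c0; rewrite /pser seriesEord /= addnC big_split_ord /= big1 ?add0r.
  by rewrite seriesEord mulr_sumr; apply: eq_bigr => i _; rewrite exprD mulrCA.
by move=> i _; rewrite c0 ?mul0r.
Qed.

Lemma cvg_pser_shift c m s l : s != 0 -> (forall i, (i < m)%N -> c i = 0) ->
  pser c s @ \oo --> s ^+ m * l <-> pser (fun i => c (m + i)%N) s @ \oo --> l.
Proof.
move=> s0 c0; rewrite -(cvg_shiftn m (pser c s)).
have -> : (fun n => pser c s (n + m)%N) =
    (fun n => s ^+ m * pser (fun i => c (m + i)%N) s n).
  by apply/funext => n; exact: pser_shift.
split=> h; last by apply: cvgMl_tmp.
have sm0 : s ^+ m != 0 by rewrite expf_neq0.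
rewrite -[l](mulKf sm0).
rewrite -[X in X @ _](_ : (fun n => (s ^+ m)^-1 *
  (s ^+ m * pser (fun i => c (m + i)%N) s n)) = _); first exact: cvgMl_tmp.
by apply/funext => n; rewrite mulKf.
Qed.

(** Zeros of a power series are isolated. Once the coefficients below [n] vanish, dividing by
    [s ^+ n] makes [c n] the constant term, and [pser_near0] at a zero [s] close to 0 forces it to
    vanish. *)
Lemma pser_coef0 c r : 0 < r -> cvgn (pser c r) ->
  (forall e, 0 < e -> exists s, [/\ s != 0, `|s| < e & pser c s @ \oo --> (0 : R)]) ->
  forall n, c n = 0.
Proof.
move=> r0 cr hz n; elim/ltn_ind: n => n IH.
have r_neq0 : r != 0 by rewrite gt_eqF.
have cdr : cvgn (pser (fun i => c (n + i)%N) r).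
  apply/cvg_ex; exists ((r ^+ n)^-1 * limn (pser c r)).
  by apply/cvg_pser_shift => //; rewrite mulVKf ?expf_neq0.
have [B hB] := pser_near0 r0 cdr.
apply/eqP/negPn/negP => cn0.
(* The first bound makes [hB] applicable; the second makes B|s| smaller than |c n|, with |B| + 1 as
   a positive denominator whatever [B] is. *)
have e0 : 0 < Num.min (r / 2) (`|c n| / (`|B| + 1)).
  by rewrite lt_min divr_gt0// divr_gt0 ?normr_gt0// ltr_wpDl.
have [s [s0 se sz]] := hz _ e0.
move: se; rewrite lt_min => /andP[s1 s2].
have : pser (fun i => c (n + i)%N) s @ \oo --> (0 : R).
  by apply/cvg_pser_shift => //; rewrite mulr0.
move=> /(hB _ _ (ltW s1)); rewrite addn0 sub0r normrN leNgt => /negP; apply.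
move: s2; rewrite ltr_pdivlMr ?ltr_wpDl// mulrC; apply: le_lt_trans.
by rewrite ler_wpM2r// (le_trans (ler_norm B))// lerDl.
Qed.

(* The counterpart of [meromorphic_at] along a horizontal line. *)
Definition rmero (phi : R -> R) (a : R) := exists m c e, 0 < e /\
  forall s, s != 0 -> `|s| < e -> pser c s @ \oo --> s ^+ m * phi (a + s).

(** The centre [a] is left out because [rmero] does not constrain [phi a]. *)
Definition eventually0 (phi : R -> R) (a : R) := exists2 e, 0 < e &
  forall s, s != 0 -> `|s| < e -> phi (a + s) = 0.

Lemma rmero_identity phi a : rmero phi a ->
  (forall e, 0 < e -> exists s, [/\ s != 0, `|s| < e & phi (a + s) = 0]) ->
  eventually0 phi a.
Proof.
move=> [m [c [e [e0 h]]]] hz; exists e => // s s0 se.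
have c0 : forall n, c n = 0.
  apply: (@pser_coef0 _ (e / 2)); first by rewrite divr_gt0.
    apply/cvg_ex; exists ((e / 2) ^+ m * phi (a + e / 2)); apply: h.
      by rewrite gt_eqF// divr_gt0.
    by rewrite gtr0_norm ?divr_gt0// ltr_pdivrMr// ltr_pMr// ltr1n.
  move=> e' e'0; have ee0 : 0 < Num.min e e' by rewrite lt_min e0.
  have [t [t0 te t_eq0]] := hz _ ee0; move: te; rewrite lt_min => /andP[te te'].
  exists t; split => //; have := h t t0 te.
  by rewrite t_eq0 mulr0.
have := h s s0 se => /cvg_lim => /(_ (@Rhausdorff _)).
rewrite (_ : pser c s = fun=> 0); last first.
  by apply/funext => n; rewrite /pser /series /= big1 // => i _; rewrite c0 mul0r.
rewrite lim_cst; last exact: Rhausdorff.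
by move/eqP; rewrite eq_sym mulf_eq0 expf_eq0 (negPf s0) andbF /= => /eqP.
Qed.

(** Continuation to the left by an infimum argument. If [inf E] were positive, zeros from the right
    would accumulate at it, so [phi] would vanish around it, and [E] would contain a smaller
    point. *)
Lemma rmero_continuation phi (T : R) : 0 < T -> (forall a : R, 0 < a -> rmero phi a) ->
  (forall t : R, T <= t -> phi t = 0) ->
  forall a : R, 0 < a -> eventually0 phi a.
Proof.
move=> T0 mer phiT.
pose E := [set a : R | 0 < a /\ forall t : R, a < t -> eventually0 phi t].
have ET : E T.
  split=> // t Tt; exists (t - T); rewrite ?subr_gt0// => s s0.
  rewrite ltr_norml => /andP[h _]; apply: phiT; lra.
have hinf : has_inf E by split; [exists T|exists 0 => x [/ltW]].
have above (a : R) : inf E < a -> eventually0 phi a.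
  move=> /(inf_lt hinf.1)[b [b0 hb] ba]; exact: hb.
have i0 : 0 <= inf E by apply: lb_le_inf; [exists T|move=> x [/ltW]].
suff i_eq0 : inf E <= 0 by move=> a a0; apply: above; exact: le_lt_trans a0.
rewrite leNgt; apply/negP => ipos.
have [e e0 he] : eventually0 phi (inf E).
  apply: rmero_identity (mer _ ipos) _ => e e0.
  have [d d0 hd] : eventually0 phi (inf E + e / 2) by apply: above; lra.
  (* [inf E + e / 2] may itself be an excluded centre, so the zero is taken slightly to its
     right. *)
  pose s := Num.min (d / 2) (e / 4).
  have : s <= d / 2 by rewrite ge_min lexx.
  have : s <= e / 4 by rewrite ge_min lexx orbT.
  have : 0 < s by rewrite lt_min !divr_gt0.
  move=> s0 s1 s2; exists (e / 2 + s); split; [lra|rewrite gtr0_norm; lra|].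
  by rewrite addrA; apply: hd; [lra|rewrite gtr0_norm; lra].
(* The first term keeps [b] positive; the second keeps all points between [b] and [inf E] inside the
   punctured neighbourhood given by [he]. *)
pose b := Num.max (inf E / 2) (inf E - e / 2).
have b1 : inf E / 2 <= b by rewrite le_max lexx.
have b2 : inf E - e / 2 <= b by rewrite le_max lexx orbT.
have bi : b < inf E by rewrite gt_max; apply/andP; split; lra.
have : E b.
  split=> [|t bt]; first lra.
  have [it|ti|<-] := ltgtP (inf E) t; [exact: above| |by exists e].
  (* This radius keeps [t + s] strictly below the excluded point [inf E] and within [e] of it. *)
  exists (Num.min (inf E - t) (e / 2)); first by rewrite lt_min; apply/andP; split; lra.
  move=> s s0; rewrite lt_min !ltr_norml => /andP[/andP[h1 h2] /andP[h3 h4]].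
  rewrite (_ : t + s = inf E + (t + s - inf E)); last by ring.
  apply: he; first by rewrite lt_eqF//; lra.
  by rewrite ltr_norml; apply/andP; split; lra.
move=> /(ge_inf hinf.2); lra.
Qed.
End RealLaurent.

Section RealLaurentTheory.
Variable R : realType.
Implicit Types (phi psi : R -> R) (a : R).

Let delay (c : nat -> R) m : nat -> R :=
  fun n => if (n < m)%N then 0 else c (n - m)%N.

Lemma pser_delay (c : nat -> R) m (s l : R) : s != 0 ->
  pser c s @ \oo --> l -> pser (delay c m) s @ \oo --> s ^+ m * l.
Proof.
move=> s0 h; apply/cvg_pser_shift => // [i im|]; first by rewrite /delay im.
rewrite (_ : (fun i => _) = c)//; apply/funext => i.
by rewrite /delay ltnNge leq_addr /= addKn.
Qed.

(** Both expansions are brought to the common factor [s ^+ (m1 + m2)], each delayed by the exponent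
    of the other. *)
Lemma rmeroD phi psi a : rmero phi a -> rmero psi a ->
  rmero (fun t => phi t + psi t) a.
Proof.
move=> [m1 [c1 [e1 [e1_gt0 h1]]]] [m2 [c2 [e2 [e2_gt0 h2]]]].
exists (m1 + m2)%N, (fun n => delay c1 m2 n + delay c2 m1 n), (Num.min e1 e2).
split=> [|s s0]; first by rewrite lt_min e1_gt0.
rewrite lt_min => /andP[se1 se2].
have -> : pser (fun n => delay c1 m2 n + delay c2 m1 n) s =
    pser (delay c1 m2) s + pser (delay c2 m1) s.
  by rewrite /pser -seriesD; congr series; apply/funext => n; rewrite mulrDl.
have -> : s ^+ (m1 + m2) * (phi (a + s) + psi (a + s)) =
    s ^+ m2 * (s ^+ m1 * phi (a + s)) + s ^+ m1 * (s ^+ m2 * psi (a + s)).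
  by rewrite exprD; ring.
by apply: cvgD; apply: pser_delay => //; [exact: h1|exact: h2].
Qed.

Lemma rmeroZ (k : R) phi a : rmero phi a -> rmero (fun t => k * phi t) a.
Proof.
move=> [m [c [e [e0 h]]]]; exists m, (fun n => k * c n), e; split=> // s s0 se.
have -> : pser (fun n => k * c n) s = (fun n => k * pser c s n).
  apply/funext => n; rewrite /pser /series /= mulr_sumr.
  by apply: eq_bigr => i _; rewrite mulrA.
by rewrite mulrCA; apply: cvgMl_tmp; exact: h.
Qed.

Lemma rmero_sum (I : finType) (F : I -> R -> R) a :
  (forall i, rmero (F i) a) -> rmero (fun t => \sum_i F i t) a.
Proof.
move=> h; rewrite -[X in rmero X](_ : \sum_i F i = _); last first.
  by apply/funext => t; rewrite fct_sumE.
elim/big_ind: _ => [|f g|//]; last exact: rmeroD.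
exists 0%N, (fun=> 0), 1; split=> // s _ _.
rewrite mulr0 (_ : pser _ s = fun=> 0); first exact: cvg_cst.
by apply/funext => n; rewrite /pser /series /= big1// => i _; rewrite mul0r.
Qed.

(** Continuation provides zeros of [phi] at arbitrarily small positive points, and right continuity
    carries the value to 0. *)
Lemma rmero_eq0 phi (T : R) : 0 < T -> (forall a : R, 0 < a -> rmero phi a) ->
  (forall t : R, T <= t -> phi t = 0) -> phi t @[t --> 0^'+] --> phi 0 ->
  phi 0 = 0.
Proof.
move=> T0 mer phiT c0; have ev := rmero_continuation T0 mer phiT.
apply/eqP/negPn/negP => p0.
have /cvgrPdist_lt/(_ `|phi 0|) := c0; rewrite normr_gt0 => /(_ p0).
move=> [e /= e0 he].
have a0 : 0 < e / 2 by rewrite divr_gt0.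
have [d d0 hd] := ev _ a0.
pose s := Num.min (d / 2) (e / 4).
have : s <= d / 2 by rewrite ge_min lexx.
have : s <= e / 4 by rewrite ge_min lexx orbT.
have : 0 < s by rewrite lt_min !divr_gt0.
move=> s0 s1 s2.
have := he (e / 2 + s); rewrite /= hd; [|lra|rewrite gtr0_norm; lra].
rewrite subr0 ltxx sub0r normrN => H; suff : is_true false by [].
by apply: H; [rewrite gtr0_norm; lra|lra].
Qed.

End RealLaurentTheory.

(** * Real exponential sums: right continuity and power series expansion *)

Section ExponentialSums.
Variables (R : realType) (A L : nat -> R) (l : R).
Hypotheses (l_ge0 : 0 <= l) (L_ge : forall n, - l <= L n).
Hypothesis A_cvg : cvgn (series (fun n => `|A n|)).

(** A Dirichlet series along a horizontal line: [L n] will be [ln (n%:R + w)] and [A n] the part of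
    its term at the starting point. Since [w] may be less than 1, [L] is only bounded below by
    [- l]. *)
Definition expsum (t : R) : R := limn (series (fun n => A n * expR (- t * L n))).

Lemma expsum_right_continuous : expsum t @[t --> 0^'+] --> expsum 0.
Proof.
apply: (@tannery _ _ _ _ _ _ (fun n => expR l * `|A n|)).
- exact: (@is_cvg_seriesZ _ _ (expR l)).
- near=> t => n.
  have t0 : 0 < t by near: t; exact: nbhs_right_gt.
  have t1 : t < 1 by near: t; apply: nbhs_right_lt.
  rewrite normrM mulrC ler_wpM2r// ger0_norm ?expR_ge0// ler_expR.
  have h1 : 0 <= t * (L n + l) by apply: mulr_ge0; [exact: ltW|have := L_ge n; lra].
  have h2 : 0 <= (1 - t) * l by apply: mulr_ge0 => //; lra.
  lra.
- move=> n; apply: cvgMl_tmp; apply: continuous_cvg; first exact: continuous_expR.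
  apply: cvgMr_tmp; apply: cvgN; apply: cvg_at_right_filter; exact: cvg_id.
Unshelve. all: by end_near. Qed.

Lemma expR_partial_le (x : R) K : \sum_(k < K) `|x| ^+ k / k`!%:R <= expR `|x|.
Proof.
rewrite /expR; have -> : \sum_(k < K) `|x| ^+ k / k`!%:R = series (exp_coeff `|x|) K.
  by rewrite seriesEord.
apply: nondecreasing_cvgn_le; last exact: is_cvg_series_exp_coeff.
apply: nondecreasing_series => n _ _.
by rewrite exp_coeff_ge0.
Qed.

(** For [L n] nonnegative the exponent is at most 0; for [L n] negative it is (a + |s|)|L n|, and
    then |L n| is at most [l]. *)
Let weight (a s : R) n : `|s| <= a ->
  expR (- a * L n) * expR `|s * L n| <= expR (2 * a * l).
Proof.
move=> sa; have a0 : 0 <= a by apply: le_trans sa.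
rewrite -expRD ler_expR normrM; have := L_ge n.
have h1 : 0 <= (a - `|s|) * `|L n| by rewrite mulr_ge0// subr_ge0.
have h2 : 0 <= a * l by rewrite mulr_ge0.
have h3 : 0 <= (a - `|s|) * l by rewrite mulr_ge0// subr_ge0.
move=> Ll; have h4 : 0 <= (a + `|s|) * (l + L n).
  by apply: mulr_ge0; [exact: addr_ge0|lra].
by move: h1; have [Ln|Ln] := ger0P (L n) => h1; lra.
Qed.

(** Each exponential is expanded at [a] in powers of [s]. By [weight] the partial expansions are
    dominated by [b], uniformly in the number [K] of powers, so [tannery] exchanges the two
    summations. *)
Lemma expsum_rmero a : 0 < a -> rmero expsum a.
Proof.
move=> a0.
pose b n := expR (2 * a * l) * `|A n|.
have cb : cvgn (series b) by exact: (@is_cvg_seriesZ _ _ (expR (2 * a * l))).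
pose u k n := A n * expR (- a * L n) * ((- L n) ^+ k / k`!%:R).
have bound K s n : `|s| <= a ->
    `|\sum_(k < K) u k n * s ^+ k| <= b n.
  move=> sa; rewrite /u.
  under eq_bigr do rewrite -mulrA.
  rewrite -mulr_sumr !normrM (ger0_norm (expR_ge0 _)) /b [leRHS]mulrC -mulrA.
  apply: ler_wpM2l => //; apply: le_trans (weight n sa).
  apply: ler_wpM2l; first exact: expR_ge0.
  apply: le_trans (ler_norm_sum _ _ _) _.
  apply: le_trans (expR_partial_le _ K).
  apply: ler_sum => k _; rewrite -mulrA [_^-1 * _]mulrC mulrA -exprMn normrM.
  by rewrite normrX mulNr normrN mulrC (ger0_norm (_ : 0 <= k`!%:R^-1)) // mulrC [s * _]mulrC.
(* The case [s = a]: a single term of the exponential series is at most its sum, so |u k n| a^k is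
   at most [b n]. *)
have cu k : cvgn (series (u k)).
  have ak0 : 0 < a ^+ k by rewrite exprn_gt0.
  apply: (@cvg_series_dominated _ _ (fun n => (a ^+ k)^-1 * b n)); last first.
    exact: (@is_cvg_seriesZ _ _ (a ^+ k)^-1).
  move=> n; rewrite ler_pdivlMl// -[X in X * _](ger0_norm (ltW ak0)) -normrM.
  have sa : `|a| <= a by rewrite gtr0_norm.
  rewrite /u !normrM (ger0_norm (expR_ge0 _)) (ger0_norm (ltW ak0)).
  have := weight n sa; rewrite /b; set E := expR (2 * a * l) => wn.
  rewrite mulrCA [leRHS]mulrC -!mulrA ler_wpM2l//.
  apply: le_trans wn; rewrite ler_wpM2l ?expR_ge0//.
  apply: le_trans (expR_partial_le _ k.+1); rewrite big_ord_recr /=.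
  rewrite normrM exprMn (gtr0_norm a0) normrX normrN normfV normr_nat mulrA.
  rewrite lerDr; apply: sumr_ge0 => i _; apply: divr_ge0 => //.
  by rewrite exprn_ge0// mulr_ge0// ltW.
exists 0%N, (fun k => limn (series (u k))), a; split=> // s s0 /ltW sa.
rewrite expr0 mul1r.
have -> : pser (fun k => limn (series (u k))) s =
    (fun K => limn (series (fun n => \sum_(k < K) u k n * s ^+ k))).
  apply/funext; elim=> [|K IH].
    rewrite /pser /series /= big_nil.
    rewrite (_ : (fun n => _) = (fun=> 0)); last first.
      by apply/funext => n; rewrite big1// => i _; rewrite big_ord0.
    by rewrite lim_cst//; exact: Rhausdorff.
  rewrite /pser seriesSr -/(pser _ _ _) IH.
  rewrite mulrC -[X in _ + X](@lim_seriesZ _ _ (s ^+ K) (cu K)).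
  rewrite -lim_seriesD; first last.
  - exact: (@is_cvg_seriesZ _ _ (s ^+ K) (cu K)).
  - exact: cvg_series_dominated (fun n => bound K s n sa) cb.
  congr (limn (series _)); apply/funext => n.
  by rewrite big_ord_recr /=; congr (_ + _); rewrite [LHS]mulrC.
apply: tannery cb _ _; first by apply: nearW => K n; exact: bound.
move=> n.
rewrite opprD mulrDl expRD.
rewrite (_ : (fun K => _) = (fun K => A n * expR (- a * L n) * series (exp_coeff (- s * L n)) K)).
  rewrite mulrA; apply: cvgMl_tmp; exact: is_cvg_series_exp_coeff.
apply/funext => K; rewrite seriesEord /= mulr_sumr; apply: eq_bigr => k _.
rewrite /u -!mulrA; congr (_ * (_ * _)); rewrite /exp_coeff /= mulNr -mulrN exprMn.
by rewrite [s ^+ k * _]mulrC -!mulrA; congr (_ * _); rewrite mulrC.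
Qed.

End ExponentialSums.

(** * Zeta functions along horizontal lines *)

Section ComplexParts.
Variable R : realType.
Local Notation C := (R[i]^o)%type.

(** The boolean lets one argument treat real and imaginary parts together; [complex_part_inj]
    reassembles them. *)
Definition part (b : bool) (c : C) : R :=
  if b then complex.Im c else complex.Re c.

(* The real and imaginary parts of exp (- i x). *)
Definition trig (b : bool) (x : R) : R := if b then - sin x else cos x.

Lemma trig_le1 b x : `|trig b x| <= 1.
Proof.
case: b; rewrite /trig ?normrN ler_norml; first by rewrite sin_geN1 sin_le1.
by rewrite cos_geN1 cos_le1.
Qed.

Lemma complex_part_inj (c d : C) : (forall b, part b c = part b d) -> c = d.
Proof. by case: c d => [x y] [x' y'] h; have /= := h true; have /= := h false => -> ->. Qed.

Lemma partD b c d : part b (c + d) = part b c + part b d.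
Proof. by case: b c d => [] [? ?] [? ?]. Qed.

Lemma partN b c : part b (- c) = - part b c.
Proof. by case: b c => [] [? ?]. Qed.

Lemma part_sum b (I : Type) (r : seq I) (P : pred I) (F : I -> C) :
  part b (\sum_(i <- r | P i) F i) = \sum_(i <- r | P i) part b (F i).
Proof.
apply: (big_morph (part b)); first exact: partD.
by case: b.
Qed.

Lemma partZ b (c : C) (r : R) : part b (c * r%:C%C) = part b c * r.
Proof. by case: b c => [] [x y] /=; rewrite mulr0 ?subr0 ?add0r// mulrC. Qed.

Lemma norm_part b (c : C) : ((`|part b c|)%:C)%C <= `|c| :> R[i].
Proof.
rewrite normc_def lecR -sqrtr_sqr ler_sqrt ?addr_ge0 ?sqr_ge0//.
by case: b c => [] [x y] /=; rewrite ?lerDl ?lerDr sqr_ge0.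
Qed.

Lemma norm_le_parts (c : C) :
  `|c| <= ((`|part false c| + `|part true c|)%:C)%C :> R[i].
Proof.
case: c => x y /=; rewrite normc_def lecR /=.
rewrite -[leRHS]ger0_norm ?addr_ge0// -sqrtr_sqr ler_sqrt ?sqr_ge0//.
rewrite -(real_normK (num_real x)) -(real_normK (num_real y)).
by rewrite sqrrD -addrA lerD2l lerDr mulrn_wge0// mulr_ge0.
Qed.

Lemma cvg_part b (T : Type) (F : set_system T) {FF : Filter F} (u : T -> C) l :
  u @ F --> l -> part b (u x) @[x --> F] --> part b l.
Proof.
move=> /cvgrPdist_lt h; apply/cvgrPdist_lt => e e0.
have := h (e%:C)%C; rewrite ltcR => /(_ e0); apply: filterS => x hx.
by rewrite -ltcR -partN -partD; apply: le_lt_trans hx; exact: norm_part.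
Qed.

Lemma cvg_parts (T : Type) (F : set_system T) {FF : Filter F} (u : T -> C) l :
  (forall b, part b (u x) @[x --> F] --> part b l) -> u @ F --> l.
Proof.
move=> h; apply/cvgrPdist_lt => -[e e']; rewrite ltcE /= => /andP[/eqP-> e0].
have /cvgrPdist_lt/(_ (e / 2)) := h false; rewrite divr_gt0// => /(_ isT) h1.
have /cvgrPdist_lt/(_ (e / 2)) := h true; rewrite divr_gt0// => /(_ isT) h2.
near=> x; apply: le_lt_trans (norm_le_parts _) _.
rewrite -[(e +i* 0)%C]/((e%:C)%C) ltcR !partD !partN [e]splitr; apply: ltrD.
  by near: x.
by near: x.
Unshelve. all: by end_near. Qed.

Lemma part_pser b (c : nat -> C) (s : R) n :
  part b (series (fun n => c n * (s%:C)%C ^+ n) n) = pser (fun n => part b (c n)) s n.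
Proof.
rewrite /pser /series /= part_sum; apply: eq_bigr => i _.
by rewrite -rmorphXn partZ.
Qed.

(** Powers of a real increment are real, so taking a part of the Laurent expansion acts on its
    coefficients alone and keeps the exponent [m]. *)
Lemma meromorphic_at_part b (F : C -> C) (z : C) (a : R) :
  meromorphic_at F (z + (a%:C)%C) -> rmero (fun t => part b (F (z + (t%:C)%C))) a.
Proof.
move=> [m [c [e /= e0 h]]].
exists m, (fun n => part b (c n)), (complex.Re e).
move: e e0 h => [e e']; rewrite ltcE /= => /andP[/eqP-> e0] h.
split=> // s s0 se.
have := h (z + ((a + s)%:C)%C).
have -> : z + ((a + s)%:C)%C - (z + (a%:C)%C) = (s%:C)%C.
  by rewrite rmorphD opprD addrACA subrr add0r addrAC subrr add0r.
rewrite /= opprD addrACA subrr add0r -rmorphB opprD addNKr normc_def /=.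
rewrite expr0n addr0 sqrtr_sqr normrN ltcR => /(_ se).
rewrite (inj_eq (addrI z)) (inj_eq (@complexI _)) -subr_eq0 addrAC subrr add0r.
move=> /(_ s0) /(@cvg_part b); rewrite -rmorphXn mulrC partZ mulrC.
by under eq_fun do rewrite part_pser.
Qed.

(** The expansion also holds at [s = 0], which identifies the value at [z] with the constant
    coefficient; [pser_near0] bounds the deviation linearly. *)
Lemma analytic_at_part b (F : C -> C) (z : C) : analytic_at F z ->
  part b (F (z + (t%:C)%C)) @[t --> 0^'+] --> part b (F z).
Proof.
move=> [c [e /= e0 h]].
move: e e0 h => [e e']; rewrite ltcE /= => /andP[/eqP-> e0] h.
have {}h s : `|s| < e ->
    pser (fun n => part b (c n)) s @ \oo --> part b (F (z + (s%:C)%C)).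
  move=> se; have := h (z + (s%:C)%C).
  rewrite /= opprD addNKr normrN normc_def /= expr0n addr0 sqrtr_sqr ltcR.
  move=> /(_ se) /(@cvg_part b); rewrite addrAC subrr add0r.
  by under eq_fun do rewrite part_pser.
have e2 : 0 < e / 2 by rewrite divr_gt0.
have [B hB] : exists B, forall s l, `|s| <= e / 2 / 2 ->
    pser (fun n => part b (c n)) s @ \oo --> l ->
    `|l - part b (c 0%N)| <= B * `|s|.
  apply: pser_near0 e2 _; apply/cvg_ex; eexists; apply: h.
  by rewrite gtr0_norm//; lra.
have F0 : part b (F z) = part b (c 0%N).
  apply/eqP; rewrite -subr_eq0 -normr_le0.
  have := hB 0 (part b (F (z + (0%:C)%C))); rewrite rmorph0 addr0 normr0 mulr0.
  apply; first by rewrite divr_ge0// ltW.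
  by have := h 0; rewrite normr0 rmorph0 addr0; apply.
rewrite F0; apply/cvgrPdistC_lt => d d0.
near=> s.
have s0 : 0 < s by near: s; exact: nbhs_right_gt.
have s1 : s < e / 2 / 2 by near: s; apply: nbhs_right_lt; rewrite divr_gt0.
have s2 : s < d / (`|B| + 1).
  by near: s; apply: nbhs_right_lt; rewrite divr_gt0// ltr_wpDl.
have se : `|s| < e by rewrite gtr0_norm//; lra.
have := hB s _ _ (h s se); rewrite gtr0_norm// => /(_ (ltW s1)).
move=> /le_lt_trans; apply; move: s2; rewrite ltr_pdivlMr ?ltr_wpDl// mulrC.
apply: le_lt_trans; rewrite ler_wpM2r ?(ltW s0)//.
by rewrite (le_trans (ler_norm B))// lerDl.
Unshelve. all: by end_near. Qed.

End ComplexParts.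

Section ZetaOnLines.
Variable R : realType.
Local Notation C := (R[i]^o)%type.
Implicit Types (h : nat -> nat) (w x y : R) (b : bool).

(** The real or imaginary part of h(n) / (n + w)^(x + iy). *)
Definition dterm h w b x y n : R :=
  (h n)%:R * expR (- x * ln (n%:R + w)) * trig b (y * ln (n%:R + w)).

Definition dser h w b x y : R := limn (series (dterm h w b x y)).

Definition dabs_cvg h w x :=
  cvgn (series (fun n => (h n)%:R * expR (- x * ln (n%:R + w)))).

Lemma ln_shift_ge w n : 0 < w -> - `|ln w| <= ln (n%:R + w).
Proof.
move=> w0; apply: le_trans (_ : ln w <= _); first by rewrite lerNl ler_normr lexx orbT.
by rewrite ler_ln ?posrE ?lerDr// ltr_wpDl.
Qed.

Lemma dterm_le h w b x y n :
  `|dterm h w b x y n| <= (h n)%:R * expR (- x * ln (n%:R + w)).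
Proof.
rewrite /dterm normrM (ger0_norm (mulr_ge0 _ (expR_ge0 _)))//.
by rewrite ler_piMr ?trig_le1// mulr_ge0 ?expR_ge0.
Qed.

Lemma dser_cvg h w b x y : dabs_cvg h w x -> cvgn (series (dterm h w b x y)).
Proof. apply: cvg_series_dominated; exact: dterm_le. Qed.

Lemma dser_expsum h w b x y t : dser h w b (x + t) y =
  expsum (dterm h w b x y) (fun n => ln (n%:R + w)) t.
Proof.
congr (limn (series _)); apply/funext => n; rewrite /dterm opprD mulrDl expRD; ring.
Qed.

Section Zeta.
Variables (K : fieldType) (S : comAlgType K) (N : lmodType S).
Variables (N_ : nat -> set N) (w : R).
Hypothesis w_gt0 : 0 < w.
Implicit Type z : C.

Lemma zeta_termE z n : zeta_term N_ w z n =
  (((hilbert N_ n)%:R * expR (- complex.Re z * ln (n%:R + w)))%:C *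
   (trig false (complex.Im z * ln (n%:R + w)) +i*
    trig true (complex.Im z * ln (n%:R + w))))%C.
Proof.
rewrite /zeta_term /cpow /trig; set t := complex.Im z * _; set s := complex.Re z * _.
rewrite invfM mulrA mulNr expRN rmorphM rmorphV ?unitfE ?gt_eqF ?expR_gt0//=.
rewrite rmorph_nat; congr (_ * _).
by rewrite -[LHS]/(invc _) /= cos2Dsin2 !divr1.
Qed.

Lemma part_zeta_term b z n : part b (zeta_term N_ w z n) =
  dterm (hilbert N_) w b (complex.Re z) (complex.Im z) n.
Proof. by rewrite zeta_termE mulrC partZ mulrC; case: b. Qed.

Lemma norm_zeta_term z n : `|zeta_term N_ w z n| =
  (((hilbert N_ n)%:R * expR (- complex.Re z * ln (n%:R + w)))%:C)%C :> R[i].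
Proof.
rewrite zeta_termE normrM [X in _ * X]normc_def /trig /= sqrrN cos2Dsin2 sqrtr1.
by rewrite mulr1 normc_def /= expr0n addr0 sqrtr_sqr ger0_norm// mulr_ge0 ?expR_ge0.
Qed.

Lemma zeta_abs_cvgE z : zeta_abs_cvg N_ w z <-> dabs_cvg (hilbert N_) w (complex.Re z).
Proof.
rewrite /zeta_abs_cvg /dabs_cvg.
set u := fun n => (hilbert N_ n)%:R * expR (- complex.Re z * ln (n%:R + w)).
have e n : series (fun n => `|zeta_term N_ w z n| : C) n = ((series u n)%:C)%C.
  by rewrite /series /= raddf_sum; apply: eq_bigr => i _; rewrite norm_zeta_term.
split=> [/cvg_ex[l hl]|/cvg_ex[l hl]]; apply/cvg_ex.
  exists (part false l); have := @cvg_part _ false _ _ _ _ _ hl.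
  by under eq_fun do rewrite e /=; apply.
exists ((l%:C)%C : C); apply: cvg_parts => b.
under eq_fun do rewrite e.
by case: b => //=; exact: cvg_cst.
Qed.

Lemma cvg_zeta_series z : dabs_cvg (hilbert N_) w (complex.Re z) ->
  forall b, part b (zeta_series N_ w z) =
    dser (hilbert N_) w b (complex.Re z) (complex.Im z).
Proof.
move=> cz b0; pose l b := dser (hilbert N_) w b (complex.Re z) (complex.Im z).
have hl : series (zeta_term N_ w z) @ \oo --> ((l false +i* l true)%C : C).
  apply: cvg_parts => b.
  rewrite (_ : (fun n => _) =
    series (dterm (hilbert N_) w b (complex.Re z) (complex.Im z))).
    by have := @dser_cvg _ _ b _ (complex.Im z) cz; rewrite /l; case: b.
  apply/funext => n; rewrite /series /= part_sum; apply: eq_bigr => i _.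
  exact: part_zeta_term.
rewrite /zeta_series (cvg_lim _ hl); last exact: norm_hausdorff.
by case: b0.
Qed.

(* Whichever way [zeta] is defined at [z], it extends along [t |-> z + t] to the
   region of absolute convergence. Only right continuity can be asked for at
   [t = 0], as [z] may lie on the boundary of that region. *)
Lemma zeta_regular_line b z :
  (exists T, forall t, T <= t -> dabs_cvg (hilbert N_) w t) ->
  zeta_regular N_ w z ->
  exists phi : R -> R,
    [/\ phi 0 = part b (zeta N_ w z), phi t @[t --> 0^'+] --> phi 0,
        forall a : R, 0 < a -> rmero phi a &
        exists T, forall t, T <= t ->
          phi t = dser (hilbert N_) w b (complex.Re z + t) (complex.Im z)].
Proof.
move=> [T hT] reg; set h := hilbert N_; rewrite /zeta; case: asboolP => cz.
  have Ac : cvgn (series (fun n => `|dterm h w b (complex.Re z) (complex.Im z) n|)).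
    apply: cvg_series_dominated ((zeta_abs_cvgE z).1 cz) => n.
    by rewrite normr_id dterm_le.
  have Lge n : - `|ln w| <= ln (n%:R + w) by exact: ln_shift_ge.
  exists (expsum (dterm h w b (complex.Re z) (complex.Im z))
                 (fun n => ln (n%:R + w))); split.
  - by rewrite cvg_zeta_series -?dser_expsum ?addr0//; exact/zeta_abs_cvgE.
  - exact: (expsum_right_continuous (normr_ge0 _) Lge Ac).
  - exact: (expsum_rmero (normr_ge0 _) Lge Ac).
  - by exists 0 => t _; rewrite dser_expsum.
case: reg => // -[F0 hF0].
(* [F0] excludes the default value of [xget]. The selected [F] may differ from [F0], and it is this
   [F] that is followed along the line. *)
case: xgetP => [_ _ [F hF <-]|/(_ (F0 z))]; last by case; exists F0.
have [[merF FE] anF] := hF.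
exists (fun t => part b (F (z + (t%:C)%C))); split.
- by rewrite rmorph0 addr0.
- by rewrite rmorph0 addr0; exact: analytic_at_part.
- by move=> a _; exact: meromorphic_at_part.
exists (T - complex.Re z) => t Tt.
have Re_zt : complex.Re (z + (t%:C)%C) = complex.Re z + t by case: (z).
have Im_zt : complex.Im (z + (t%:C)%C) = complex.Im z by case: (z) => ? ? /=; rewrite addr0.
have ct : dabs_cvg h w (complex.Re (z + (t%:C)%C)).
  by rewrite Re_zt; apply: hT; lra.
by rewrite FE; [rewrite cvg_zeta_series// Re_zt Im_zt|exact/zeta_abs_cvgE].
Qed.

End Zeta.
End ZetaOnLines.

(** * Dirichlet series: shifts, linear combinations, half-plane of convergence *)

Section DirichletSeries.
Variable R : realType.
Implicit Types (h : nat -> nat) (w x y : R) (b : bool).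

(** The effect on a Hilbert function of twisting the module by [- k]. *)
Definition hshift (k : nat) h : nat -> nat :=
  fun n => if (k <= n)%N then h (n - k)%N else 0%N.

(** The first [k] terms vanish, and reindexing by [n + k] turns n + k + w into n + (w + k). *)
Lemma dser_shift h k w b x y : dabs_cvg h (w + k%:R) x ->
  dser (hshift k h) w b x y = dser h (w + k%:R) b x y.
Proof.
move=> ch; rewrite /dser; apply: cvg_lim; first exact: Rhausdorff.
rewrite -(cvg_shiftn k); apply: cvg_trans (@dser_cvg _ _ _ b _ y ch).
rewrite (_ : [sequence _]_n = series (dterm h (w + k%:R) b x y))//.
apply/funext => n /=; rewrite seriesEord /= addnC big_split_ord /= big1 ?add0r.
  rewrite seriesEord /=; apply: eq_bigr => i _.
  rewrite /dterm /hshift leq_addr addKn natrD.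
  by rewrite -addrA [k%:R + _]addrC -addrA [w + _]addrC addrCA.
by move=> i _; rewrite /dterm /hshift leqNgt ltn_ord !mul0r.
Qed.

Lemma dser_linear_comb (I : finType) (g : nat -> nat) (H : I -> nat -> nat)
    (c : I -> R) w b x y :
  (forall n, (g n)%:R = \sum_i c i * (H i n)%:R) ->
  (forall i, dabs_cvg (H i) w x) ->
  dser g w b x y = \sum_i c i * dser (H i) w b x y.
Proof.
move=> gH cH; rewrite /dser; apply: cvg_lim; first exact: Rhausdorff.
rewrite (_ : series _ = fun N => \sum_i c i * series (dterm (H i) w b x y) N).
  apply: cvg_big => [|i _]; first exact: add_continuous.
  by apply: cvgMl_tmp; exact: dser_cvg.
apply/funext => N; rewrite /series /=; under [RHS]eq_bigr do rewrite mulr_sumr.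
rewrite exchange_big; apply: eq_bigr => n _; rewrite /dterm gH !mulr_suml.
by apply: eq_bigr => i _; rewrite !mulrA.
Qed.

Lemma cvg_series_telescoping_harmonic :
  cvgn (series (fun n => n.+1%:R^-1 - n.+2%:R^-1 : R)).
Proof.
rewrite (_ : series _ = fun n => 1 - n.+1%:R^-1).
  apply: is_cvgB; first exact: is_cvg_cst.
  by apply/cvg_ex; exists 0; exact: cvg_harmonic.
apply/funext; elim=> [|n IH]; first by rewrite /series /= big_nil invr1 subrr.
by rewrite seriesSr IH addrA subrK.
Qed.

(** Since n + w is at least min(1, w)(n + 1), the terms are at most a constant times (n + 1)^(-2),
    which is at most twice the telescoping term 1/((n + 1)(n + 2)). *)
Lemma dabs_cvg_poly h w (D r : nat) : 0 < w ->
  (forall n, (h n <= D * n.+1 ^ r)%N) ->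
  forall t : R, r.+2%:R <= t -> dabs_cvg h w t.
Proof.
move=> w0 hD t rt.
have t0 : 0 <= t by apply: le_trans rt.
pose mu := Num.min 1 w.
have mu0 : 0 < mu by rewrite lt_min ltr01.
pose B := D%:R * expR (- t * ln mu) * 2.
apply: (@cvg_series_dominated _ _ (fun n => B * (n.+1%:R^-1 - n.+2%:R^-1))); last first.
  exact: (@is_cvg_seriesZ _ _ B cvg_series_telescoping_harmonic).
move=> n; rewrite ger0_norm ?mulr_ge0 ?expR_ge0//.
have n1 : 0 < n.+1%:R :> R by rewrite ltr0n.
have hn : (h n)%:R <= D%:R * n.+1%:R ^+ r :> R by rewrite -natrX -natrM ler_nat.
have Ln : ln mu + ln n.+1%:R <= ln (n%:R + w).
  rewrite -lnM ?posrE// ler_ln ?posrE ?mulr_gt0 ?ltr_wpDl//.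
  rewrite -natr1 mulrDr mulr1; apply: lerD; last by rewrite ge_min lexx orbT.
  by rewrite ler_piMl// ge_min lexx.
have ln1 : 0 <= ln n.+1%:R :> R by rewrite ln_ge0// ler1n.
have hE : expR (- t * ln (n%:R + w)) <= expR (- t * ln mu) * (n.+1%:R ^+ r.+2)^-1.
  rewrite -[n.+1%:R in leRHS](lnK n1) -expRM_natl -expRN -expRD ler_expR.
  have h1 : 0 <= t * (ln (n%:R + w) - (ln mu + ln n.+1%:R)).
    by rewrite mulr_ge0// subr_ge0.
  have h2 : 0 <= (t - r.+2%:R) * ln n.+1%:R by rewrite mulr_ge0// subr_ge0.
  lra.
apply: le_trans (ler_pM _ (expR_ge0 _) hn hE) _ => //.
rewrite [leLHS](_ : _ = D%:R * expR (- t * ln mu) * (n.+1%:R ^- 2)); last first.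
  rewrite -addn2 exprD; field.
  by rewrite ?expf_neq0 ?gt_eqF.
rewrite /B -!mulrA ler_wpM2l// ler_wpM2l ?expR_ge0//.
have n2 : 0 < n.+2%:R :> R by rewrite ltr0n.
rewrite -subr_ge0 (_ : _ - _ = n%:R / (n.+1%:R ^+ 2 * n.+2%:R)).
  by rewrite divr_ge0// mulr_ge0// exprn_ge0.
rewrite -[n.+2%:R]natr1 -[n.+1%:R]natr1; field.
rewrite natr1 natr1 !gt_eqF//.
Qed.

End DirichletSeries.

(** * Hilbert functions *)

Section RelativeBases.
Variables (K : fieldType) (S : comAlgType K) (N : lmodType S).
Implicit Types (U : submodClosed N) (V : set N).

Lemma scaleAr_sum (I : finType) (a : K) (c : I -> K) (b : I -> N) :
  a%:A *: (\sum_i (c i)%:A *: b i) = \sum_i (a * c i)%:A *: b i :> N.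
Proof.
rewrite scaler_sumr; apply: eq_bigr => i _.
by rewrite scalerA -scalerAl mul1r scalerA.
Qed.

(** Bases of the image of [V] in N/U are described by representatives in [N], so that all stages of
    the filtration are handled inside one module. *)
Definition indep_mod U d (b : 'I_d -> N) := forall c : 'I_d -> K,
  \sum_i (c i)%:A *: b i \in U -> forall i, c i = 0.

Definition span_mod U V d (b : 'I_d -> N) := forall x, V x ->
  exists c : 'I_d -> K, x - \sum_i (c i)%:A *: b i \in U.

Definition basis_mod U V d (b : 'I_d -> N) :=
  [/\ forall i, V (b i), indep_mod U b & span_mod U V b].

(** If [d] exceeded [e], the coordinate matrix of [b] in terms of [s] would have a nonzero left
    kernel vector, which is a nontrivial relation of [b] modulo [U]. *)
Lemma indep_span_leq U V d e (b : 'I_d -> N) (s : 'I_e -> N) :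
  (forall i, V (b i)) -> indep_mod U b -> span_mod U V s -> (d <= e)%N.
Proof.
move=> Vb ib ss; rewrite leqNgt; apply/negP => de.
have [A hA] := choice (fun i => ss _ (Vb i)).
pose M := \matrix_(i < d, j < e) A i j.
have : kermx M != 0.
  rewrite kermx_eq0; apply/negP => /eqP rM.
  by have := rank_leq_col M; rewrite rM leqNgt de.
move=> /rowV0Pn[u /sub_kermxP uM]; apply/negP; rewrite negbK; apply/eqP/rowP => i.
rewrite mxE; apply: (ib (fun i => u 0 i)).
have -> : \sum_i (u 0 i)%:A *: b i =
    \sum_i (u 0 i)%:A *: (b i - \sum_j (A i j)%:A *: s j).
  under [RHS]eq_bigr do rewrite scalerBr scaleAr_sum.
  rewrite sumrB exchange_big /= [X in _ - X]big1 ?subr0// => j _.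
  rewrite -scaler_suml -scaler_suml.
  have /rowP/(_ j) := uM; rewrite !mxE; under eq_bigr do rewrite mxE.
  by move=> ->; rewrite !scale0r.
by apply: rpred_sum => j _; apply: rpredZ.
Qed.

Lemma basis_mod_uniq U V d e (b : 'I_d -> N) (b' : 'I_e -> N) :
  basis_mod U V b -> basis_mod U V b' -> d = e.
Proof.
move=> [Vb ib sb] [Vb' ib' sb']; apply/eqP; rewrite eqn_leq.
by rewrite (indep_span_leq Vb ib sb') (indep_span_leq Vb' ib' sb).
Qed.

(** A spanning family of minimal size is independent: a relation with a nonzero coefficient would
    make one member redundant. *)
Lemma basis_mod_exists U V e (s : 'I_e -> N) :
  (forall i, V (s i)) -> span_mod U V s ->
  exists d (b : 'I_d -> N), basis_mod U V b.
Proof.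
move=> Vs ss.
pose P d := `[< exists b : 'I_d -> N, (forall i, V (b i)) /\ span_mod U V b >].
have exP : exists d, P d by exists e; apply/asboolP; exists s.
case: (ex_minnP exP) => d /asboolP[b [Vb sb]] dmin; exists d, b; split=> // c cU i.
apply/eqP/negPn/negP => ci0.
case: d => [|d] in b dmin Vb sb c cU i ci0 *; first by case: i {ci0}.
suff /dmin : P d by rewrite ltnn.
apply/asboolP; exists (b \o lift i); split=> [j|x /sb[a ha]]; first exact: Vb.
(* Subtracting [a i / c i] times the relation cancels the coordinate at [i]. *)
exists (fun j => a (lift i j) - a i / c i * c (lift i j)).
set y := \sum_(j < d) _.
have -> : x - y = (x - \sum_i (a i)%:A *: b i) +
    (a i / c i)%:A *: (\sum_i (c i)%:A *: b i).
  rewrite scaleAr_sum -addrA; congr (x + _).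
  rewrite -[RHS]opprK opprD opprK -sumrB; congr (- _).
  under [RHS]eq_bigr do rewrite -scalerBl -scalerBl.
  by rewrite (bigD1_ord i)//= divfK// subrr !scale0r add0r.
by apply: rpredD => //; apply: rpredZ.
Qed.

Lemma mem_seq_submod_nil (x : N) : (x \in @seq_submod _ N [::]) = (x == 0).
Proof.
apply/idP/eqP => [/asboolP[m ->]|->]; last exact: rpred0.
by rewrite big_ord0.
Qed.

Lemma is_basisP V d (b : 'I_d -> N) :
  is_basis V b <-> basis_mod (@seq_submod _ N [::]) V b.
Proof.
split=> -[Vb ib sb]; split=> //.
- by move=> c; rewrite mem_seq_submod_nil => /eqP; exact: ib.
- by move=> x /sb[c ->]; exists c; rewrite subrr rpred0.
- by move=> c c0; apply: ib; rewrite mem_seq_submod_nil c0.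
- by move=> x /sb[c]; rewrite mem_seq_submod_nil subr_eq0 => /eqP; exists c.
Qed.

Lemma dimK_basis V d (b : 'I_d -> N) : is_basis V b -> dimK V = d.
Proof.
move=> hb; rewrite /dimK; case: xgetP => [d' -> [b' hb']|/(_ d)].
  exact: basis_mod_uniq ((is_basisP _ _).1 hb') ((is_basisP _ _).1 hb).
by case; exists b.
Qed.

End RelativeBases.

(** * Homogeneous components in a graded group *)

Section HomogeneousComponents.
Variables (V : zmodType) (V_ : nat -> set V).
Hypothesis V_gr : is_grading V_.

Lemma gradingN n x : V_ n x -> V_ n (- x).
Proof. by move=> h; rewrite -sub0r; apply: (gradingB V_gr) => //; exact: (grading0 V_gr). Qed.

Lemma gradingD n x y : V_ n x -> V_ n y -> V_ n (x + y).
Proof. by move=> hx hy; rewrite -[y]opprK; apply: (gradingB V_gr) => //; exact: gradingN. Qed.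

Lemma grading_sum_closed n (I : Type) (r : seq I) (P : pred I) (F : I -> V) :
  (forall i, P i -> V_ n (F i)) -> V_ n (\sum_(i <- r | P i) F i).
Proof.
by move=> h; apply: (big_ind (V_ n)) => //; [exact: (grading0 V_gr)|exact: gradingD].
Qed.

(** Asking for equality at every large [N] lets two decompositions be compared at a common bound. *)
Definition components x (c : nat -> V) := (forall n, V_ n (c n)) /\
  exists N0, forall N, (N0 <= N)%N -> x = \sum_(n < N) c n.

Lemma components_exist x : exists c, components x c.
Proof.
have [N0 [c [Vc ->]]] := grading_sum V_gr x.
exists (fun n => if (n < N0)%N then c n else 0); split.
  by move=> n; case: ifP => // _; exact: (grading0 V_gr).
exists N0 => N NN; rewrite (big_ord_widen _ c NN) big_mkcond.
by apply: eq_bigr => i _.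
Qed.

Lemma components_uniq x c d : components x c -> components x d -> c = d.
Proof.
move=> [Vc [N1 h1]] [Vd [N2 h2]]; apply/funext => n; apply/eqP.
rewrite -subr_eq0; apply/eqP; pose N := (maxn (maxn N1 N2) n.+1).
apply: (grading_direct V_gr (N := N) (c := fun n => c n - d n)).
- by move=> m; apply: (gradingB V_gr).
- by rewrite sumrB -h1 -?h2 ?subrr// /N !leq_max leqnn ?orbT.
- by rewrite /N leq_max leqnn orbT.
Qed.

Definition component n x := xget (fun=> 0) [set c | components x c] n.

Lemma componentP x : components x (component^~ x).
Proof. exact: (xgetPex (fun=> 0) (components_exist x)). Qed.

Lemma component_eq x c : components x c -> forall n, component n x = c n.
Proof. by move=> h n; rewrite -(components_uniq (componentP x) h). Qed.

Lemma component_homog n x : V_ n (component n x).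
Proof. exact: (componentP x).1. Qed.

Lemma componentB n x y : component n (x - y) = component n x - component n y.
Proof.
have [Vc [N1 h1]] := componentP x; have [Vd [N2 h2]] := componentP y.
apply: (@component_eq _ (fun n => component n x - component n y)).
split=> [m|]; first exact: (gradingB V_gr).
by exists (maxn N1 N2) => N; rewrite geq_max => /andP[? ?]; rewrite sumrB -h1 -?h2.
Qed.

Lemma component_of_homog m x : V_ m x ->
  forall n, component n x = if n == m then x else 0.
Proof.
move=> hx; apply: component_eq; split=> [n|].
  by case: eqP => [->//|_]; exact: (grading0 V_gr).
exists m.+1 => N mN; rewrite (bigD1 (Ordinal mN)) //= eqxx big1 ?addr0// => i ne.
by rewrite ifN//; apply: contraNneq ne => im; apply/eqP/val_inj.
Qed.

End HomogeneousComponents.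

(** * Relative dimensions when one regular element is added *)

Section HilbertRecurrence.
Variables (K : fieldType) (S : comAlgType K) (S_ : nat -> set S).
Variables (M : lmodType S) (M_ : nat -> set M).
Hypotheses (S_gr : positively_graded S_) (M_gr : fg_graded_module S_ M_).
Let Mg := fgm_grading M_gr.
Local Notation pr := (component M_).

Lemma component_scale k a n x : S_ k a ->
  pr n (a *: x) = if (k <= n)%N then a *: pr (n - k)%N x else 0.
Proof.
move=> ka; have [Vc [N0 h]] := componentP Mg x.
move: n; apply: (component_eq Mg (c := fun n => if (k <= n)%N then a *: pr (n - k)%N x else 0)).
split=> [n|].
  case: ifPn => [kn|_]; last exact: (grading0 Mg).
  by rewrite -{1}(subnKC kn); apply: (fgm_scale M_gr) => //; exact: Vc.
exists (k + N0)%N => N kN.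
have kN' : (k <= N)%N by apply: leq_trans kN; exact: leq_addr.
rewrite -(subnKC kN') big_split_ord /= big1 ?add0r => [|i _]; last first.
  by rewrite leqNgt ltn_ord.
rewrite [in LHS](h (N - k)%N) ?scaler_sumr; last first.
  by rewrite leq_subRL.
by apply: eq_bigr => i _; rewrite leq_addr addKn.
Qed.

Lemma homogeneous_scaler n c x : M_ n x -> M_ n (c%:A *: x).
Proof.
move=> hx; rewrite -[n]add0n; apply: (fgm_scale M_gr) => //.
by rewrite (pgr_zero S_gr); exists c.
Qed.

Definition homogeneous (U : {pred M}) := forall n x, x \in U -> pr n x \in U.

Section Step.
Variables (U U' : submodClosed M) (a : S) (k : nat).
Hypotheses (ka : S_ k a) (U_homog : homogeneous U).
Hypothesis U'E : forall x, x \in U' <-> exists m, x - a *: m \in U.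

Lemma homogeneous_step : homogeneous U'.
Proof.
move=> n x /U'E[m hm]; apply/U'E; move/(U_homog n): hm.
rewrite componentB// (component_scale _ _ ka); case: ifP => _; first by exists (pr (n - k)%N m).
by rewrite subr0 => h; exists 0; rewrite scaler0 subr0.
Qed.

Hypothesis a_regular : forall x, a *: x \in U -> x \in U.

(* The exact sequence 0 -> (M/U)(-k) -> M/U -> M/U' -> 0. *)
Lemma basis_mod_step n d e (b : 'I_d -> M) (c : 'I_e -> M) :
  basis_mod U' (M_ n) b ->
  basis_mod U (if (k <= n)%N then M_ (n - k)%N else [set 0]) c ->
  basis_mod U (M_ n) (fun i : 'I_(d + e) => match fintype.split i with
    | inl i => b i | inr j => a *: c j end).
Proof.
move=> [Vb ib sb] [Vc ic sc].
have sumE (r : 'I_(d + e) -> K) : \sum_i (r i)%:A *: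
    (match fintype.split i with inl i => b i | inr j => a *: c j end) =
    \sum_i (r (lshift e i))%:A *: b i +
    a *: (\sum_j (r (rshift d j))%:A *: c j).
  rewrite big_split_ord /=; congr (_ + _).
    by apply: eq_bigr => i _; rewrite (unsplitK (inl i)).
  rewrite scaler_sumr; apply: eq_bigr => j _.
  by rewrite (unsplitK (inr j)) !scalerA mulrC.
split.
- move=> i; case: fintype.split => // j; have := Vc j; case: ifP => [kn|_ ->].
    by rewrite -{2}(subnKC kn); exact: (fgm_scale M_gr).
  by rewrite scaler0; exact: (grading0 Mg).
- move=> r; rewrite sumE => hr.
  (* Modulo [U'] the multiples of [a] disappear, which kills the coordinates along [b]; regularity
     of [a] then cancels it in front of the combination of the [c j]. *)
  have rb : forall i, r (lshift e i) = 0.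
    apply: (ib (fun i => r (lshift e i))); apply/U'E.
    by exists (- \sum_j (r (rshift d j))%:A *: c j); rewrite scalerN opprK.
  have rc : forall j, r (rshift d j) = 0.
    apply: (ic (fun j => r (rshift d j))); apply: a_regular; move: hr.
    by rewrite big1 ?add0r// => i _; rewrite rb !scale0r.
  by move=> i; rewrite -(splitK i); case: fintype.split => j /=.
- move=> x xn; have [r /U'E[m]] := sb _ xn.
  set y := x - _ => /(U_homog n); rewrite componentB// (component_scale _ _ ka).
  have yn : M_ n y.
    apply: (gradingB Mg) => //; apply: (grading_sum_closed Mg) => i _.
    exact: homogeneous_scaler.
  rewrite (component_of_homog Mg yn) eqxx.
  (* The element [m] need not be homogeneous. Taking degree [n] components of a relation in the
     homogeneous [U] replaces it by its part of degree [n - k], which [c] spans. *)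
  pose m' := if (k <= n)%N then pr (n - k)%N m else 0.
  have -> : (if (k <= n)%N then a *: pr (n - k)%N m else 0) = a *: m'.
    by rewrite /m'; case: ifP; rewrite ?scaler0.
  move=> hm.
  have [r' hr'] : exists r' : 'I_e -> K, m' - \sum_j (r' j)%:A *: c j \in U.
    by apply: sc; rewrite /m'; case: ifP => // _; exact: (component_homog Mg).
  exists (fun i => match fintype.split i with inl i => r i | inr j => r' j end).
  rewrite sumE; under eq_bigr do rewrite (unsplitK (inl _)).
  under [X in a *: X]eq_bigr do rewrite (unsplitK (inr _)).
  rewrite opprD addrA -/y.
  rewrite (_ : y - _ = y - a *: m' + a *: (m' - \sum_j (r' j)%:A *: c j)).
    by apply: rpredD => //; apply: rpredZ.
  by rewrite scalerBr addrA subrK.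
Qed.

End Step.
End HilbertRecurrence.

(** * Hilbert functions along the filtration by a regular sequence *)

Section RegularSequence.
Variables (K : fieldType) (S : comAlgType K) (S_ : nat -> set S).
Variables (M : lmodType S) (M_ : nat -> set M).
Hypotheses (S_gr : positively_graded S_) (M_gr : fg_graded_module S_ M_).
Let Mg := fgm_grading M_gr.

Lemma mem_seq_submod_rcons (f : seq S) (a : S) (x : M) :
  x \in seq_submod (rcons f a) <-> exists m, x - a *: m \in seq_submod f.
Proof.
split=> [/asboolP[m ->]|[m0 /asboolP[m hm]]].
  rewrite size_rcons big_ord_recr /= nth_rcons ltnn eqxx.
  exists (m (size f)); rewrite addrK; apply/asboolP; exists m.
  by apply: eq_bigr => i _; rewrite nth_rcons ltn_ord.
apply/asboolP; exists (fun i => if i == size f then m0 else m i).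
rewrite size_rcons big_ord_recr /= nth_rcons ltnn eqxx.
rewrite -[LHS](subrK (a *: m0)) hm; congr (_ + _).
by apply: eq_bigr => i _; rewrite nth_rcons ltn_ord ltn_eqF.
Qed.

Lemma quot_pi_eq0 (f : seq S) (x : M) : (quot_pi f x == 0) = (x \in seq_submod f).
Proof.
rewrite -[x in RHS]subr0 -quot_pi_eq; congr (_ == _).
apply: (addrI (quot_pi f (0 : M))).
by rewrite -quot_piD !addr0.
Qed.

Lemma quot_pi_sum (f : seq S) (I : Type) (r : seq I) (P : pred I) (F : I -> M) :
  quot_pi f (\sum_(i <- r | P i) F i) = \sum_(i <- r | P i) quot_pi f (F i).
Proof.
apply: (big_morph (quot_pi f)); first exact: quot_piD.
by apply/eqP; rewrite quot_pi_eq0 rpred0.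
Qed.

Lemma quot_piZ (f : seq S) (a : S) (x : M) : quot_pi f (a *: x) = a *: quot_pi f x.
Proof. by rewrite -[RHS]/(quot_scale a (quot_pi f x)) quot_scale_pi. Qed.

Lemma is_basis_quot (f : seq S) (V : set M) d (b : 'I_d -> M) :
  basis_mod (@seq_submod _ M f) V b ->
  is_basis [set quot_pi f x | x in V] (fun i => quot_pi f (b i)).
Proof.
have sumE (c : 'I_d -> K) : \sum_i (c i)%:A *: quot_pi f (b i) =
    quot_pi f (\sum_i (c i)%:A *: b i).
  by rewrite quot_pi_sum; apply: eq_bigr => i _; rewrite quot_piZ.
move=> [Vb ib sb]; split.
- by move=> i; exists (b i).
- by move=> c /eqP; rewrite sumE quot_pi_eq0; exact: ib.
- move=> _ [x /sb[c hc] <-]; exists c.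
  by rewrite sumE; apply/eqP; rewrite quot_pi_eq.
Qed.

Variables (p : nat) (f : p.-tuple S) (k : 'I_p -> nat).
Hypothesis f_homog : forall i : 'I_p, S_ (k i) (tnth f i).
Hypothesis f_regular : regular_sequence M f.

Local Notation U j := (@seq_submod _ M (take j f)).

Lemma mem_filtration (j : 'I_p) x :
  x \in U j.+1 <-> exists m, x - tnth f j *: m \in U j.
Proof.
rewrite (take_nth 0) ?size_tuple// (tnth_nth 0); exact: mem_seq_submod_rcons.
Qed.

Lemma filtration_regular (j : 'I_p) x : tnth f j *: x \in U j -> x \in U j.
Proof.
rewrite -!quot_pi_eq0 quot_piZ (tnth_nth 0) => /eqP h; apply/eqP.
by apply: f_regular.1 h; rewrite size_tuple.
Qed.

Lemma filtration_homogeneous j : (j <= p)%N -> homogeneous M_ (U j).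
Proof.
elim: j => [_ n x|j IH jp].
  rewrite take0 !mem_seq_submod_nil => /eqP ->.
  by rewrite (component_of_homog Mg (grading0 Mg 0%N)) if_same.
apply: (homogeneous_step M_gr (f_homog (Ordinal jp)) (IH (ltnW jp))).
exact: (mem_filtration (Ordinal jp)).
Qed.

Variable e : nat -> nat.
Hypothesis M_span : forall n, exists s : 'I_(e n) -> M,
  (forall i, M_ n (s i)) /\
  forall x, M_ n x -> exists c : 'I_(e n) -> K, x = \sum_i (c i)%:A *: s i.

Lemma basis_mod_fin (W : submodClosed M) n :
  exists d (b : 'I_d -> M), basis_mod W (M_ n) b.
Proof.
have [s [Ms ss]] := M_span n; apply: (basis_mod_exists Ms).
by move=> x /ss[c ->]; exists c; rewrite subrr rpred0.
Qed.

(** Here [h j n] is the dimension of [M_ n] modulo the first [j] elements. The recurrence compares a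
    basis of that size with the one built by [basis_mod_step]. *)
Lemma hilbert_filtration : exists h : nat -> nat -> nat,
  [/\ h 0%N = hilbert M_, h p = hilbert (quot_grading f M_),
      forall n, (h 0%N n <= e n)%N &
      forall (j : 'I_p) n, h j n = (h j.+1 n + hshift (k j) (h j) n)%N].
Proof.
have [h hh] := choice (fun jn : nat * nat => basis_mod_fin (U jn.1) jn.2).
exists (fun j n => h (j, n)); split.
- apply/funext => n; have [b hb] := hh (0%N, n); rewrite /= take0 in hb.
  by rewrite /hilbert (dimK_basis ((is_basisP _ _).2 hb)).
- apply/funext => n; have [b hb] := hh (p, n).
  rewrite /= take_oversize ?size_tuple// in hb.
  by rewrite /hilbert (dimK_basis (is_basis_quot hb)).
- move=> n; have [b [Mb ib _]] := hh (0%N, n); have [s [Ms ss]] := M_span n.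
  have ss0 : span_mod (U 0) (M_ n) s.
    by move=> x /ss[c ->]; exists c; rewrite subrr rpred0.
  exact: indep_span_leq Mb ib ss0.
- move=> j n; have [b hb] := hh (val j, n); have [b1 hb1] := hh (j.+1, n).
  have jp : (j <= p)%N by exact: ltnW.
  have step := basis_mod_step S_gr M_gr (f_homog j) (filtration_homogeneous jp)
    (mem_filtration j) (@filtration_regular j) hb1.
  rewrite /hshift; case: ifP step => kn step.
    have [b2 hb2] := hh (val j, n - k j)%N.
    exact: (basis_mod_uniq hb (step _ _ hb2)).
  (* For [n] below [k j] the source of the multiplication is zero, with the empty basis. *)
  apply: (basis_mod_uniq hb (step 0%N (fun=> 0) _)); split=> //.
    by move=> c _ [].
  by move=> x ->; exists (fun=> 0); rewrite big_ord0 subr0 rpred0.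
Qed.

End RegularSequence.

(** * Inclusion-exclusion over subsets of the sequence *)

Section InclusionExclusion.

Lemma hshift_hshift a b h : hshift a (hshift b h) = hshift (a + b) h.
Proof.
apply/funext => n; rewrite /hshift; case: (leqP a n) => an.
  by rewrite subnDA leq_subRL.
by rewrite leqNgt (leq_trans an (leq_addr _ _)).
Qed.

Lemma sum_subsets_setU1 (I : finType) (V : nmodType) (i : I) (D : {set I})
    (F : {set I} -> V) : i \notin D ->
  \sum_(A : {set I} | A \subset i |: D) F A =
  \sum_(A : {set I} | A \subset D) F A + \sum_(A : {set I} | A \subset D) F (i |: A).
Proof.
move=> iD; rewrite (bigID (fun A : {set I} => i \in A)) /= addrC; congr (_ + _).
  apply: eq_bigl => A; apply/andP/idP => [[AD iA]|AD].
    apply/fintype.subsetP => x xA; have /(fintype.subsetP AD) := xA.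
    by rewrite !inE => /orP[/eqP xi|//]; rewrite -xi xA in iA.
  split; first by apply: (fintype.subset_trans AD); exact: finset.subsetUr.
  by apply: contra iD; exact: (fintype.subsetP AD).
rewrite (reindex_onto (fun A => i |: A) (fun A => A :\ i)) /=; last first.
  by move=> A /andP[_ iA]; rewrite finset.setD1K.
apply: eq_bigl => A; apply/andP/idP => [[/andP[AD _] /eqP <-]|AD].
  by rewrite finset.subDset.
have iA : i \notin A by apply: contra iD; exact: (fintype.subsetP AD).
by rewrite finset.setU1K// finset.setU11 finset.setUS.
Qed.

(** Induction on the number [j] of elements used, over subsets of the first [j] indices. The term
    subtracted at step [j] accounts for the subsets containing [j]: its sign flips and its shifts
    compose. *)
Lemma inclusion_exclusion (R : comPzRingType) p (k : 'I_p -> nat) (h : nat -> nat -> nat) :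
  (forall (j : 'I_p) n, h j n = (h j.+1 n + hshift (k j) (h j) n)%N) ->
  forall n, (h p n)%:R = \sum_(A : {set 'I_p})
    (-1) ^+ #|A| * (hshift (\sum_(i in A) k i) (h 0%N) n)%:R :> R.
Proof.
move=> hE n; pose D (j : nat) : {set 'I_p} := [set i : 'I_p | (i < j)%N]%SET.
suff H j : (j <= p)%N -> forall n, (h j n)%:R = \sum_(A : {set 'I_p} | A \subset D j)
    (-1) ^+ #|A| * (hshift (\sum_(i in A) k i) (h 0%N) n)%:R :> R.
  rewrite (H p (leqnn p)); apply: eq_bigl => A.
  suff -> : A \subset D p by [].
  by apply/fintype.subsetP => i _; rewrite inE.
elim: j => [_ {}n|j IH jp {}n].
  rewrite (big_pred1 finset.set0) => [|A]; last first.
    have -> : D 0%N = finset.set0 by apply/finset.setP => i; rewrite !inE.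
    by rewrite finset.subset0.
  by rewrite cards0 expr0 mul1r big_set0 /hshift leq0n subn0.
pose i := Ordinal jp.
have -> : (h j.+1 n)%:R = (h j n)%:R - (hshift (k i) (h j) n)%:R :> R.
  by rewrite (hE i) /= natrD addrK.
have iD : i \notin D j by rewrite inE ltnn.
have -> : D j.+1 = i |: D j.
  by apply/finset.setP => l; rewrite !inE ltnS leq_eqVlt -val_eqE.
rewrite sum_subsets_setU1// (IH (ltnW jp)); congr (_ + _).
have -> : (hshift (k i) (h j) n)%:R = \sum_(A : {set 'I_p} | A \subset D j)
    (-1) ^+ #|A| * (hshift (k i) (hshift (\sum_(i in A) k i) (h 0%N)) n)%:R :> R.
  rewrite {1}/hshift; case: ifP => kn.
    rewrite (IH (ltnW jp)); apply: eq_bigr => A _.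
    by rewrite [hshift (k i) _ _]/hshift kn.
  by rewrite big1// => A _; rewrite /hshift kn mulr0.
rewrite -sumrN; apply: eq_bigr => A AD.
have iA : i \notin A by apply: contra iD; exact: (fintype.subsetP AD).
by rewrite hshift_hshift cardsU1 iA exprS mulN1r mulNr big_setU1.
Qed.

Lemma sum_by_card (V : nmodType) p (F : {set 'I_p} -> V) :
  \sum_(A : {set 'I_p}) F A =
  F finset.set0 + \sum_(1 <= l < p.+1) \sum_(A : {set 'I_p} | #|A| == l) F A.
Proof.
have -> : F finset.set0 = \sum_(A : {set 'I_p} | #|A| == 0%N) F A.
  by rewrite (big_pred1 finset.set0)// => A; rewrite cards_eq0.
rewrite -(big_ltn (F := fun l => \sum_(A : {set 'I_p} | #|A| == l) F A))//.
rewrite big_mkord (exchange_big_dep xpredT)//=; apply: eq_bigr => A _.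
have Ap : (#|A| < p.+1)%N by rewrite ltnS -[X in (_ <= X)%N]card_ord max_card.
by rewrite (big_pred1 (Ordinal Ap))// => l; rewrite -val_eqE eq_sym.
Qed.

End InclusionExclusion.

(** * Polynomial growth of the Hilbert function *)

Section PolynomialGrowth.

Lemma subalg_closed_sum (K : fieldType) (S : comAlgType K) (A : {pred S})
    (I : Type) (r : seq I) (P : pred I) (F : I -> S) : GRing.subalg_closed A ->
  (forall i, P i -> F i \in A) -> \sum_(i <- r | P i) F i \in A.
Proof.
move=> [A1 Al Am] h; have A0 : 0 \in A by have := Al (-1) _ _ A1 A1; rewrite scaleN1r addNr.
apply: (big_ind (fun x => x \in A)) => // x y Ax Ay; by have := Al 1 _ _ Ax Ay; rewrite scale1r.
Qed.

Lemma submod_closed_sum (S : pzRingType) (M : lmodType S) (A : {pred M})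
    (I : Type) (r : seq I) (P : pred I) (F : I -> M) : GRing.submod_closed A ->
  (forall i, P i -> F i \in A) -> \sum_(i <- r | P i) F i \in A.
Proof.
move=> [A0 Al] h; apply: (big_ind (fun x => x \in A)) => // x y Ax Ay.
by have := Al 1 _ _ Ax Ay; rewrite scale1r.
Qed.

Variables (K : fieldType) (S : comAlgType K) (S_ : nat -> set S).
Variables (M : lmodType S) (M_ : nat -> set M).
Hypotheses (S_gr : positively_graded S_) (M_gr : fg_graded_module S_ M_).
Let Sg := pgr_grading S_gr.
Let Mg := fgm_grading M_gr.
Local Notation pr := (component M_).

(** Each generator is replaced by its components of positive degree; its degree 0 component is a
    scalar and lies in every subalgebra. *)
Lemma homogeneous_algebra_generators : exists l : seq (nat * S),
  (forall u, u \in l -> (0 < u.1)%N /\ S_ u.1 u.2) /\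
  forall A : {pred S}, GRing.subalg_closed A ->
    (forall u, u \in l -> u.2 \in A) -> forall a, a \in A.
Proof.
have [gens hgens] := pgr_fg S_gr.
suff [l [lp lA]] : exists l : seq (nat * S),
    (forall u, u \in l -> (0 < u.1)%N /\ S_ u.1 u.2) /\
    forall A : {pred S}, GRing.subalg_closed A ->
      (forall u, u \in l -> u.2 \in A) -> {subset gens <= A}.
  by exists l; split=> // A cA hA; apply: hgens => //; exact: lA.
elim: gens {hgens} => [|g gens [l [lp lA]]]; first by exists [::].
have [Vc [N hN]] := componentP Sg g.
exists ([seq (n.+1, component S_ n.+1 g) | n <- iota 0 N] ++ l); split=> [u|A cA hA].
  by rewrite mem_cat => /orP[/mapP[n _ ->]|/lp//].
move=> x; rewrite inE => /orP[/eqP ->|]; last first.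
  by apply: lA => // u ul; apply: hA; rewrite mem_cat ul orbT.
rewrite (hN N.+1 (leqnSn N)) big_ord_recl; have [A1 Al Am] := cA.
have : component S_ 0 g \in A.
  have := Vc 0%N; rewrite (pgr_zero S_gr) => -[c _ <-].
  have A0 : 0 \in A by have := Al (-1) _ _ A1 A1; rewrite scaleN1r addNr.
  by have := Al c _ _ A1 A0; rewrite addr0.
move=> h0; have := Al 1 _ _ h0; rewrite scale1r; apply.
apply: subalg_closed_sum => // i _.
apply: (hA (i.+1, component S_ i.+1 g)); rewrite mem_cat; apply/orP; left.
by apply/mapP; exists (val i) => //; rewrite mem_iota /=.
Qed.

Lemma homogeneous_module_generators : exists l : seq (nat * M),
  (forall u, u \in l -> M_ u.1 u.2) /\
  forall A : {pred M}, GRing.submod_closed A ->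
    (forall u, u \in l -> u.2 \in A) -> forall x, x \in A.
Proof.
have [gens hgens] := fgm_fg M_gr.
suff [l [lp lA]] : exists l : seq (nat * M),
    (forall u, u \in l -> M_ u.1 u.2) /\
    forall A : {pred M}, GRing.submod_closed A ->
      (forall u, u \in l -> u.2 \in A) -> {subset gens <= A}.
  by exists l; split=> // A cA hA; apply: hgens => //; exact: lA.
elim: gens {hgens} => [|g gens [l [lp lA]]]; first by exists [::].
have [Vc [N hN]] := componentP Mg g.
exists ([seq (n, pr n g) | n <- iota 0 N] ++ l); split=> [u|A cA hA].
  by rewrite mem_cat => /orP[/mapP[n _ ->]|/lp//].
move=> x; rewrite inE => /orP[/eqP ->|]; last first.
  by apply: lA => // u ul; apply: hA; rewrite mem_cat ul orbT.
rewrite (hN N (leqnn N)); apply: submod_closed_sum => // i _.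
apply: (hA (val i, pr i g)); rewrite mem_cat; apply/orP; left.
by apply/mapP; exists (val i) => //; rewrite mem_iota /=.
Qed.

Section Monomials.
Variables (r s : nat) (a : 'I_r -> S) (d : 'I_r -> nat) (g : 'I_s -> M) (dg : 'I_s -> nat).
Hypotheses (d_gt0 : forall i, (0 < d i)%N) (a_homog : forall i, S_ (d i) (a i)).
Hypothesis g_homog : forall j, M_ (dg j) (g j).
Hypothesis a_gen : forall A : {pred S}, GRing.subalg_closed A ->
  (forall i, a i \in A) -> forall b, b \in A.
Hypothesis g_gen : forall A : {pred M}, GRing.submod_closed A ->
  (forall j, g j \in A) -> forall x, x \in A.

Let mono (e : 'I_r -> nat) (j : 'I_s) : M := (\prod_i a i ^+ e i) *: g j.
Let deg (e : 'I_r -> nat) (j : 'I_s) := (\sum_i e i * d i + dg j)%N.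

(** As the [d i] are positive, exponents in degree [n] are at most [n], so this type of s(n + 1)^r
    indices suffices; [monomial] sends indices of another degree to 0. *)
Definition monomial_index n := ({ffun 'I_r -> 'I_n.+1} * 'I_s)%type.

Definition monomial n (u : monomial_index n) : M :=
  if deg (fun i => u.1 i) u.2 == n then mono (fun i => u.1 i) u.2 else 0.

Let W n x := exists c : monomial_index n -> K, x = \sum_u (c u)%:A *: monomial u.

Lemma homogeneous_prod (e : 'I_r -> nat) : S_ (\sum_i e i * d i)%N (\prod_i a i ^+ e i).
Proof.
have S1 : S_ 0%N 1 by rewrite (pgr_zero S_gr); exists 1 => //; rewrite scale1r.
apply: (big_rec2 (fun b n => S_ n b)) => // i b n _ hb.
apply: (pgr_mul S_gr) => //; elim: (e i) => [|q IH]; first by rewrite expr0.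
by rewrite exprS mulSn; apply: (pgr_mul S_gr).
Qed.

Lemma monomial_homog n (u : monomial_index n) : M_ n (monomial u).
Proof.
rewrite /monomial; case: eqP => [{1}<-|_]; last exact: (grading0 Mg).
apply: (fgm_scale M_gr); [exact: homogeneous_prod|exact: g_homog].
Qed.

Let W0 n : W n 0.
Proof. by exists (fun=> 0); rewrite big1// => u _; rewrite !scale0r. Qed.

Let WD n x y : W n x -> W n y -> W n (x + y).
Proof.
move=> [c ->] [c' ->]; exists (fun u => c u + c' u); rewrite -big_split.
by apply: eq_bigr => u _; rewrite !scalerDl.
Qed.

Let WZ n (b : K) x : W n x -> W n (b%:A *: x).
Proof. by move=> [c ->]; exists (fun u => b * c u); rewrite scaleAr_sum. Qed.

Let Wmono n e j : deg e j = n -> W n (mono e j).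
Proof.
move=> den.
have en i : (e i < n.+1)%N.
  rewrite ltnS -den /deg (bigD1 i)//= -addnA; apply: leq_trans (leq_addr _ _).
  by rewrite leq_pmulr.
pose u : monomial_index n := ([ffun i => Ordinal (en i)], j).
have ue : (fun i => u.1 i : nat) = e by apply/funext => i; rewrite ffunE.
exists (fun v => (v == u)%:R); rewrite (bigD1 u)//= eqxx !scale1r big1 ?addr0.
  by rewrite /monomial ue den eqxx.
by move=> v /negPf ->; rewrite !scale0r.
Qed.

Let Wmul n i x : W n x -> W (d i + n)%N (a i *: x).
Proof.
move=> [c ->]; rewrite scaler_sumr; apply: (big_ind (W (d i + n)%N)) => //; first exact: WD.
move=> u _; rewrite scalerA mulrC -scalerA; apply: WZ.
rewrite /monomial; case: eqP => [den|_]; last by rewrite scaler0.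
pose e l := (u.1 l + (l == i))%N.
have -> : a i *: mono (fun l => u.1 l) u.2 = mono e u.2.
  rewrite /mono scalerA; congr (_ *: _); rewrite (bigD1 i)//= [in RHS](bigD1 i)//=.
  rewrite mulrA; congr (_ * _); first by rewrite /e eqxx addn1 exprS.
  by apply: eq_bigr => l /negPf li; rewrite /e li addn0.
apply: Wmono; rewrite -[in RHS]den /deg addnA; congr (_ + _)%N.
rewrite (bigD1 i)//= [in RHS](bigD1 i)//= addnA; congr (_ + _)%N.
  by rewrite /e eqxx mulnDl mul1n addnC.
by apply: eq_bigr => l /negPf li; rewrite /e li addn0.
Qed.

(** The elements whose components are all spanned by monomials. [Q] is shown to be a submodule
    containing the generators, hence all of [M]. *)
Let Q : {pred M} := fun x => `[< forall n, W n (pr n x) >].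

Let QD x y : x \in Q -> y \in Q -> x + y \in Q.
Proof.
move=> /asboolP hx /asboolP hy; apply/asboolP => n.
have prN0 z : pr n (- z) = - pr n z.
  by rewrite -sub0r componentB// (component_of_homog Mg (grading0 Mg 0%N)) if_same sub0r.
by rewrite -[y]opprK componentB// prN0 opprK; exact: WD.
Qed.

Let QZ (b : K) x : x \in Q -> b%:A *: x \in Q.
Proof.
move=> /asboolP hx; apply/asboolP => n.
have b0 : S_ 0%N b%:A by rewrite (pgr_zero S_gr); exists b.
by rewrite (component_scale M_gr n x b0) leq0n subn0; exact: WZ.
Qed.

(** The scalars that preserve [Q] form a subalgebra, and it contains the generators [a i]. *)
Let Q_scale (b : S) x : x \in Q -> b *: x \in Q.
Proof.
pose A : {pred S} := fun b => `[< forall x, x \in Q -> b *: x \in Q >].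
suff /asboolP : b \in A by apply.
apply: a_gen => [|i].
  split; first by apply/asboolP => y; rewrite scale1r.
    move=> c u v /asboolP hu /asboolP hv; apply/asboolP => y yQ.
    rewrite scalerDl; apply: QD; last exact: hv.
    by rewrite -[u]mul1r scalerAl -scalerA; apply: QZ; exact: hu.
  move=> u v /asboolP hu /asboolP hv; apply/asboolP => y yQ.
  by rewrite -scalerA; apply: hu; exact: hv.
apply/asboolP => y /asboolP hy; apply/asboolP => n.
rewrite (component_scale M_gr n y (a_homog i)); case: ifP => // dn.
by rewrite -{1}(subnKC dn); exact: Wmul.
Qed.

Lemma monomials_span n x : M_ n x ->
  exists c : monomial_index n -> K, x = \sum_u (c u)%:A *: monomial u.
Proof.
move=> xn; have /asboolP/(_ n) : x \in Q; last first.
  by rewrite (component_of_homog Mg xn) eqxx.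
apply: g_gen => [|j].
  split=> [|b u v uQ vQ]; last by apply: QD => //; exact: Q_scale.
  by apply/asboolP => m; rewrite (component_of_homog Mg (grading0 Mg 0%N)) if_same.
apply/asboolP => m; rewrite (component_of_homog Mg (g_homog j)).
case: eqP => // mj; have -> : g j = mono (fun=> 0%N) j.
  by rewrite /mono big1 ?scale1r// => i _; rewrite expr0.
by apply: Wmono; rewrite /deg big1 ?add0n// => i _; rewrite mul0n.
Qed.

End Monomials.

Lemma homogeneous_span_poly : exists (e : nat -> nat) (D r : nat),
  (forall n, e n <= D * n.+1 ^ r)%N /\
  forall n, exists s : 'I_(e n) -> M, (forall i, M_ n (s i)) /\
    forall x, M_ n x -> exists c : 'I_(e n) -> K, x = \sum_i (c i)%:A *: s i.
Proof.
have [l [lp lA]] := homogeneous_algebra_generators.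
have [m [mp mA]] := homogeneous_module_generators.
pose tl := in_tuple l; pose tm := in_tuple m.
pose I n := monomial_index (size l) (size m) n.
exists (fun n => #|{: I n}|), (size m), (size l); split=> [n|n].
  by rewrite card_prod card_ffun !card_ord mulnC.
pose v := @monomial _ _ (fun i => (tnth tl i).2) (fun i => (tnth tl i).1)
  (fun i => (tnth tm i).2) (fun i => (tnth tm i).1) n.
exists (fun i => v (enum_val i)); split=> [i|x xn].
  by apply: monomial_homog => j; [case: (lp _ (mem_tnth j tl))|exact: mp (mem_tnth j tm)].
have [c ->] : exists c : I n -> K, x = \sum_u (c u)%:A *: v u.
  apply: monomials_span => //.
  - by move=> i; case: (lp _ (mem_tnth i tl)).
  - by move=> i; case: (lp _ (mem_tnth i tl)).
  - by move=> j; exact: mp (mem_tnth j tm).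
  - by move=> A cA hA; apply: lA => // u /(@tnthP _ _ tl)[i ->].
  - by move=> A cA hA; apply: mA => // u /(@tnthP _ _ tm)[i ->].
exists (fun i => c (enum_val i)).
by rewrite (reindex (@enum_val _ {: I n}))//; exact: onW_bij (enum_val_bij _).
Qed.

End PolynomialGrowth.

(** * Comparison of the two sides along the horizontal line through z *)

Theorem corollary1p5 (R : realType) (K : fieldType)
    (S : comAlgType K) (S_ : nat -> set S)
    (M : lmodType S) (M_ : nat -> set M) (w : R)
    (p : nat) (f : p.-tuple S) (k : 'I_p -> nat)
    (S_graded : positively_graded S_) (M_graded : fg_graded_module S_ M_)
    (w_gt0 : 0 < w)
    (f_homog : forall i : 'I_p, S_ (k i) (tnth f i))
    (f_regular : regular_sequence M f)
    (z : R[i]^o)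
    (zeta_quot_regular : zeta_regular (quot_grading f M_) w z)
    (zeta_M_regular : zeta_regular M_ w z)
    (zeta_shift_regular : forall A : {set 'I_p}, (0 < #|A|)%N ->
       zeta_regular M_ (w + (\sum_(i in A) k i)%:R) z) :
  zeta (quot_grading f M_) w z =
    zeta M_ w z +
    \sum_(1 <= l < p.+1) (-1) ^+ l *
      \sum_(A : {set 'I_p} | #|A| == l)
        zeta M_ (w + (\sum_(i in A) k i)%:R) z.
Proof.
have [e [D [r [eD M_span]]]] := homogeneous_span_poly S_graded M_graded.
have [h [h0E hpE he hrec]] :=
  hilbert_filtration S_graded M_graded f_homog f_regular M_span.
pose kA (A : {set 'I_p}) := (\sum_(i in A) k i)%N.
have h0D n : (h 0%N n <= D * n.+1 ^ r)%N by exact: leq_trans (eD n).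
(* By the recurrence [h j n] decreases with [j], so one polynomial bound, and hence one half-plane
   of convergence, serves every stage. *)
have hD j n : (j <= p)%N -> (h j n <= D * n.+1 ^ r)%N.
  elim: j => // j IH jp; apply: leq_trans (IH (ltnW jp)).
  by rewrite (hrec (Ordinal jp)) leq_addr.
have shiftD A n : (hshift (kA A) (h 0%N) n <= D * n.+1 ^ r)%N.
  rewrite /hshift; case: ifP => // kn; apply: leq_trans (h0D _) _.
  rewrite leq_mul2l; apply/orP; right.
  by case: (r) => [|q]; rewrite ?expn0// leq_exp2r// ltnS leq_subr.
have wA_gt0 (A : {set 'I_p}) : 0 < w + (kA A)%:R by rewrite ltr_wpDr.
have regA (A : {set 'I_p}) : zeta_regular M_ (w + (kA A)%:R) z.
  have [A0|A0] := posnP #|A|; last exact: zeta_shift_regular.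
  by rewrite /kA (cards0_eq A0) big_set0 addr0.
(* The leading term is that of the empty subset, which gives one signed sum over all subsets. *)
have -> : zeta M_ w z + \sum_(1 <= l < p.+1) (-1) ^+ l *
    \sum_(A : {set 'I_p} | #|A| == l) zeta M_ (w + (\sum_(i in A) k i)%:R) z =
    \sum_(A : {set 'I_p}) (-1) ^+ #|A| * zeta M_ (w + (kA A)%:R) z.
  rewrite sum_by_card cards0 expr0 mul1r /kA big_set0 addr0; congr (_ + _).
  apply: eq_bigr => l _; rewrite mulr_sumr.
  by apply: eq_bigr => A /eqP ->.
apply: complex_part_inj => b; rewrite part_sum.
have [phiQ [phiQ0 cQ mQ [TQ hTQ]]] : exists phi : R -> R,
    [/\ phi 0 = part b (zeta (quot_grading f M_) w z), phi t @[t --> 0^'+] --> phi 0,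
        forall a : R, 0 < a -> rmero phi a &
        exists T, forall t, T <= t ->
          phi t = dser (h p) w b (complex.Re z + t) (complex.Im z)].
  rewrite hpE; apply: zeta_regular_line => //; exists r.+2%:R.
  by apply: (dabs_cvg_poly (D := D)) => // n; rewrite -hpE hD.
have /choice[phi hphi] : forall A : {set 'I_p}, exists phi : R -> R,
    [/\ phi 0 = part b (zeta M_ (w + (kA A)%:R) z), phi t @[t --> 0^'+] --> phi 0,
        forall a : R, 0 < a -> rmero phi a &
        exists T, forall t, T <= t ->
          phi t = dser (h 0%N) (w + (kA A)%:R) b (complex.Re z + t) (complex.Im z)].
  move=> A; rewrite h0E; apply: zeta_regular_line; [exact: wA_gt0| |exact: regA].
  exists r.+2%:R; apply: (@dabs_cvg_poly _ _ _ D) (wA_gt0 A) _ => n.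
  by rewrite -h0E.
have /choice[T hT] : forall A : {set 'I_p}, exists T, forall t, T <= t ->
    phi A t = dser (h 0%N) (w + (kA A)%:R) b (complex.Re z + t) (complex.Im z).
  by move=> A; case: (hphi A).
(* The part [b] of the difference of the two sides, continued along [z + t]. *)
pose gap t := phiQ t + (-1) * \sum_(A : {set 'I_p}) (-1) ^+ #|A| * phi A t.
suff : gap 0 = 0.
  rewrite /gap mulN1r => /subr0_eq; rewrite phiQ0 => ->.
  apply: eq_bigr => A _; case: (hphi A) => -> _ _ _.
  by rewrite -[X in X * zeta _ _ _](rmorph_sign (real_complex R)) [in RHS]mulrC partZ mulrC.
(* Beyond [T1] every continuation equals its Dirichlet series, and the real part of [z + t] is at
   least [r.+2], where these series converge absolutely. *)
pose T1 := 1 + `|TQ| + \sum_(A : {set 'I_p}) `|T A| + (r.+2%:R + `|complex.Re z|).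
have sumT_ge0 : 0 <= \sum_(A : {set 'I_p}) `|T A| by apply: sumr_ge0.
have r_ge0 : 0 <= r.+2%:R :> R by [].
have T1_gt0 : 0 < T1.
  by rewrite /T1; have := normr_ge0 TQ; have := normr_ge0 (complex.Re z); lra.
apply: (rmero_eq0 T1_gt0).
- move=> a a0; apply: rmeroD; first exact: mQ.
  apply: rmeroZ; apply: rmero_sum => A; apply: rmeroZ.
  by case: (hphi A) => _ _ mA _; exact: mA.
- move=> t T1t; rewrite /gap mulN1r; apply/eqP; rewrite subr_eq0; apply/eqP.
  have xt : r.+2%:R <= complex.Re z + t.
    have := ler_norm (- complex.Re z); rewrite normrN.
    by move: T1t; rewrite /T1; have := normr_ge0 TQ; lra.
  rewrite hTQ; last first.
    by move: T1t; rewrite /T1; have := ler_norm TQ; have := normr_ge0 (complex.Re z); lra.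
  (* Inclusion-exclusion is applied coefficientwise; [dser_shift] then trades each shift of the
     Hilbert function for a shift of [w]. *)
  rewrite (@dser_linear_comb _ _ _ (fun A : {set 'I_p} => hshift (kA A) (h 0%N))
    (fun A => (-1) ^+ #|A|)); last 2 first.
  + exact: inclusion_exclusion.
  + by move=> A; apply: (dabs_cvg_poly (D := D)) xt.
  apply: eq_bigr => A _; rewrite dser_shift; last exact: (dabs_cvg_poly (D := D)) xt.
  rewrite hT//.
  have TA : `|T A| <= \sum_(B : {set 'I_p}) `|T B|.
    by rewrite (bigD1 A)//= lerDl sumr_ge0.
  move: T1t; rewrite /T1; have := ler_norm (T A); have := normr_ge0 TQ.
  by have := normr_ge0 (complex.Re z); lra.
- rewrite /gap; apply: cvgD => //; apply: cvgMl_tmp.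
  apply: cvg_big => [|A _]; first exact: add_continuous.
  by apply: cvgMl_tmp; case: (hphi A).
Qed.
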